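(* Let $P$ be an algebraically closed field of characteristic $p>2$, let $n\ge 1$ and $G_n=Sp_{2n}(P)$. Let $\phi_n^1$ be the irreducible rational representation of $G_n$ with highest weight $\omega_n'$ and $\phi_n^2$ the irreducible rational representation with highest weight $\omega_n''$. Then for $i=1,2$: (A) $\dim \phi_n^i=\dfrac{p^n+(-1)^i}{2}$; (B) every weight of $\phi_n^i$ (with respect to a maximal torus of $G_n$) occurs with multiplicity $1$, i.e. all weight subspaces of $\phi_n^i$ are $1$-dimensional.
   Context: $G_n=Sp_{2n}(P)$ is regarded as the simply connected simple algebraic group of type $C_n$, with simple roots $\alpha_1,\dots,\alpha_n$ labelled as in Bourbaki ($\alpha_n$ is the long simple root) and corresponding fundamental weights $\omega_1,\dots,\omega_n$. Define $\omega_n'=\omega_{n-1}+\frac{p-3}{2}\omega_n$ if $n>1$ and $\omega_1'=\frac{p-3}{2}\omega_1$ if $n=1$; define $\omega_n''=\frac{p-1}{2}\omega_n$. *)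

(* Defs.v *)
From HB Require Import structures.
From mathcomp Require Import all_boot all_order all_algebra.
From mathcomp.multinomials Require Import mpoly.
Set Implicit Arguments. Unset Strict Implicit. Unset Printing Implicit Defensive.
Import Order.TTheory GRing.Theory Num.Theory.
Local Open Scope ring_scope.

Section Sp.
Variables (P : fieldType) (n : nat).

Definition Jform : 'M[P]_(n + n) := block_mx 0 1%:M (- 1%:M) 0.

Definition inSp (g : 'M[P]_(n + n)) : Prop := g^T *m Jform *m g = Jform.

Definition torus_elt (t : 'I_n -> P) : 'M[P]_(n + n) :=
  block_mx (diag_mx (\row_i t i)) 0 0 (diag_mx (\row_i (t i)^-1)).

(* weights = characters of the torus, identified with Z^n via
   t |-> prod_i t_i^(chi_i)  (chi_i = coefficient of epsilon_i) *)
Definition char_val (chi : 'I_n -> int) (t : 'I_n -> P) : P :=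
  \prod_i (t i) ^ (chi i).

Section Rep.
Variables (m : nat) (rho : 'M[P]_(n + n) -> 'M[P]_m).

Definition is_rational_rep : Prop :=
  [/\ rho 1%:M = 1%:M,
      (forall g h, inSp g -> inSp h -> rho (g *m h) = rho g *m rho h)
    & exists Q : 'I_m -> 'I_m -> {mpoly P[(n + n) * (n + n)]},
        forall g, inSp g -> forall i j, rho g i j = (Q i j).@[fun k => mxvec g 0 k]].

(* a subspace W of column vectors is encoded by U : rows of U are the
   transposes of spanning vectors of W; W is G-stable iff U rho(g)^T <= U *)
Definition is_irreducible : Prop :=
  (0 < m)%N /\
  forall U : 'M[P]_m,
    (forall g, inSp g -> (U *m (rho g)^T <= U)%MS) -> U = 0 \/ row_full U.

Definition is_weight_vec (chi : 'I_n -> int) (v : 'cV[P]_m) : Prop :=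
  forall t : 'I_n -> P, (forall i, t i != 0) ->
    rho (torus_elt t) *m v = char_val chi t *: v.

Definition is_weight (chi : 'I_n -> int) : Prop :=
  exists v, v != 0 /\ is_weight_vec chi v.

End Rep.
End Sp.

(* Simple roots of type C_n (Bourbaki) in epsilon-coordinates (0-indexed):
   alpha_i = eps_i - eps_(i+1) for i < n-1, alpha_(n-1) = 2 eps_(n-1) (long). *)
Definition simple_root (n : nat) (i : 'I_n) : 'I_n -> int :=
  fun j => if (i.+1 < n)%N then (val j == val i)%:R - (val j == i.+1)%:R
           else 2 * (val j == val i)%:R.

Definition dom_le (n : nat) (mu lam : 'I_n -> int) : Prop :=
  exists c : 'I_n -> nat, forall j, lam j - mu j = \sum_i (c i)%:Z * simple_root i j.

Definition has_highest_weight (P : fieldType) (n m : nat)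
    (rho : 'M[P]_(n + n) -> 'M[P]_m) (lam : 'I_n -> int) : Prop :=
  is_weight rho lam /\ forall mu, is_weight rho mu -> dom_le mu lam.

(* fundamental weight omega_k (1-indexed k) = eps_1 + ... + eps_k *)
Definition fund_weight (n k : nat) : 'I_n -> int := fun j => ((val j < k)%N)%:R.

Arguments fund_weight : clear implicits.


Definition omega' (n p : nat) : 'I_n -> int :=
  if (1 < n)%N then fun j => fund_weight n n.-1 j + ((p - 3)./2)%:Z * fund_weight n n j
  else fun j => ((p - 3)./2)%:Z * fund_weight n 1 j.

Definition omega'' (n p : nat) : 'I_n -> int :=
  fun j => ((p - 1)./2)%:Z * fund_weight n n j.
Arguments omega' : clear implicits.
Arguments omega'' : clear implicits.

(* Main.v *)
Require Import Defs.
From HB Require Import structures.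
From mathcomp Require Import all_boot all_order all_algebra.
From mathcomp.multinomials Require Import mpoly.
From mathcomp Require Import zify.
From Stdlib Require Import Classical_Prop.
Set Implicit Arguments. Unset Strict Implicit. Unset Printing Implicit Defensive.
Import Order.TTheory GRing.Theory Num.Theory.
Local Open Scope ring_scope.

(** Let W be the truncated polynomial ring P[x_1..x_n]/(x_i^p).  Conjugation by
    an invertible operator of W can realize every symplectic substitution of the
    operators d/dx_i and x_i, and does so for exactly one operator of
    determinant 1, because 1 is the only p^n-th root of unity in P.  This makes W
    a representation of Sp_2n(P), the Weil representation, in which the monomial
    x^a has weight (p-1)/2 - a; the weights are thus distinct, and the even and
    odd parts have dimensions (p^n + 1)/2 and (p^n - 1)/2, with highest weight
    vectors 1 and x_n.
    To compare a part of W with an irreducible module V of the same highest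
    weight, consider the matrix coefficient of g between a highest weight vector
    and a dual one.  On the big cell it depends only on the highest weight.
    Every g is a product of two elements of the big cell, and moving along a
    one-parameter torus shows that the coefficients of V and W agree on all of
    Sp_2n(P).  As both vectors are cyclic, the coefficient determines the module:
    the span of the pairs (g v, g w) is the graph of an isomorphism. *)

(** The operator [Weil g] is chosen element by element, and nothing shows directly that its entries
    are algebraic functions of [g]; they are explicit only on the torus. This obstacle shapes the
    comparison. Agreement of coefficients is not deduced from density of the big cell but checked
    along curves obtained by conjugation with the torus [tau], where the coefficients of both
    modules are Laurent functions of one variable. The shift (p-1)/2 in the weights comes from the
    determinant condition: it makes the weights of all monomials add up to zero. At the monomials 1
    and x_n it yields the weights omega'' and omega'. Cyclicity of the two vectors is where
    characteristic p interferes, since exponentials of the quadratic operators in x_i and d/dx_i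
    have to stop before the p-th power. The truncated exponential still realizes a root element,
    because the error contains a p-th power of a generator, which is zero. Its linear coefficient
    gives back the quadratic operator, and these operators connect all monomials of one parity. *)

(** * Polynomial identities over an algebraically closed field *)

Section InfiniteField.
Variable P : closedFieldType.

(** Unless [q + 1] is a nonzero constant it has a root, at which [q] would take the value -1. *)
Lemma poly_vanish (q : {poly P}) : (forall x, q.[x] = 0) -> q = 0.
Proof.
move=> q0; case: (eqVneq (size (q + 1)) 1%N) => [s1 | /closed_rootP [x]]; last first.
  by rewrite /root hornerD q0 hornerC add0r oner_eq0.
have /eqP/size_poly1P [c c0 qE] := s1.
have {}qE : q = (c - 1)%:P by rewrite polyCB -qE addrK.
by move: (q0 0); rewrite qE hornerC => ->.
Qed.

Lemma poly_eq_generic (Q p q : {poly P}) :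
  Q != 0 -> (forall r, Q.[r] != 0 -> p.[r] = q.[r]) -> p = q.
Proof.
move=> Q0 pq; apply/eqP; rewrite -subr_eq0.
have: (p - q) * Q = 0.
  apply: poly_vanish => x; rewrite hornerM hornerD hornerN.
  by case: (eqVneq Q.[x] 0) => [->|/pq ->]; rewrite ?mulr0 // subrr mul0r.
by move/eqP; rewrite mulf_eq0 (negPf Q0) orbF.
Qed.

Lemma poly_eq_pos (p q : {poly P}) :
  (forall r, r != 0 -> p.[r] = q.[r]) -> p = q.
Proof.
move=> pq; apply: (@poly_eq_generic 'X); first by rewrite polyX_eq0.
by move=> r; rewrite hornerX; exact: pq.
Qed.

Lemma generic_point (Q : {poly P}) : Q != 0 -> exists r, Q.[r] != 0.
Proof.
move=> Q0; apply: NNPP => h; case/eqP: Q0; apply: poly_vanish => x.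
by apply/eqP; apply: contraT => nz; case: h; exists x.
Qed.

End InfiniteField.

(** * Spans of arbitrary sets of vectors *)

Section Spans.
Variable F : fieldType.

(** The set may be the orbit of an infinite group, so its span is built classically, adjoining
    vectors until the rank stops growing. The universal property lets linear conditions on the span
    be checked on generators. *)
Lemma span_pred (k : nat) (S : 'rV[F]_k -> Prop) : exists U : 'M[F]_k,
  (forall x, S x -> (x <= U)%MS) /\
  (forall l (U' : 'M_(l, k)), (forall x, S x -> (x <= U')%MS) -> (U <= U')%MS).
Proof.
suff main (d : nat) : forall U : 'M[F]_k, (k - \rank U <= d)%N ->
  (forall l (U' : 'M_(l, k)), (forall x, S x -> (x <= U')%MS) -> (U <= U')%MS) ->
  exists U : 'M[F]_k, (forall x, S x -> (x <= U)%MS) /\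
  (forall l (U' : 'M_(l, k)), (forall x, S x -> (x <= U')%MS) -> (U <= U')%MS).
  by apply: (main k 0) => [|l U' _]; rewrite ?leq_subr ?sub0mx.
elim: d => [|d IH] U rU minU.
  exists U; split=> // x _; apply: submx_full.
  by rewrite /row_full eqn_leq rank_leq_col -subn_eq0 -leqn0.
case: (classic (forall x, S x -> (x <= U)%MS)) => [h|h]; first by exists U.
have [x [Sx xU]] : exists x, S x /\ ~ (x <= U)%MS.
  by apply: NNPP => h'; apply: h => x Sx; apply: NNPP => xU; apply: h'; exists x.
apply: (IH (U + x)%MS); last first.
  by move=> l U' hU'; rewrite addsmx_sub minU // hU'.
have : (U < U + x)%MS.
  by rewrite ltmxE addsmxSl /= addsmx_sub submx_refl /=; apply/negP.
move/rank_ltmx => lt; rewrite -ltnS; apply: leq_trans rU.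
by rewrite ltn_sub2l // (leq_trans lt) // rank_leq_col.
Qed.

(** The kernel of [M *m cokermx U] is the preimage of [U] under [M]; with it, stability of a span is
    tested on generators. *)
Lemma preimage_sub (k l m : nat) (x : 'M[F]_(l, k)) (M : 'M_k) (U : 'M_(m, k)) :
  (x <= kermx (M *m cokermx U))%MS = (x *m M <= U)%MS.
Proof. by rewrite sub_kermx mulmxA submxE. Qed.

End Spans.

(** * p-th powers in characteristic p *)

Section Unipotent.
Variables (F : fieldType) (p : nat).
Hypothesis hp : p \in [pchar F].

Let p_pr : prime p := pcharf_prime hp.

Lemma mx_1D_exp_pchar (k : nat) (M : 'M[F]_k) : (1 + M) ^+ p = 1 + M ^+ p.
Proof.
have pk (A : 'M[F]_k) : A *+ p = 0.
  by apply/matrixP=> a b; rewrite mulmxnE mulrn_pchar // mxE.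
rewrite exprDn_comm; last exact: commr_sym (commr1 _).
have [q pE] : exists q, p = q.+1 by exists p.-1; rewrite prednK ?prime_gt0.
have q_pr : prime q.+1 by rewrite -pE.
rewrite pE big_ord_recl big_ord_recr /= subn0 expr1n bin0 mulr1n expr0 mulr1.
rewrite subnn expr1n mul1r binn mulr1n big1 ?add0r // => i _.
have /dvdnP[c ->] : (q.+1 %| 'C(q.+1, lift ord0 i))%N.
  by rewrite prime_dvd_bin // lift0 /= ltnS ltn_ord.
by rewrite mulrnA -pE pk.
Qed.

Lemma mx_1D_exp_pcharX (k j : nat) (M : 'M[F]_k) :
  (1 + M) ^+ (p ^ j) = 1 + M ^+ (p ^ j).
Proof.
elim: j => [|j IH]; first by rewrite !expr1.
by rewrite expnSr !exprM IH mx_1D_exp_pchar.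
Qed.

(** [(x - 1) ^+ (p ^ j)] equals [x ^+ (p ^ j) - 1]. This settles the scalars left open later, by a
    determinant or by an eigenvalue of a unipotent element. *)
Lemma exp_pcharX_eq1 (x : F) (j : nat) : x ^+ (p ^ j) = 1 -> x = 1.
Proof.
move=> x1; apply/eqP; rewrite -subr_eq0; have /eqP: (x - 1) ^+ (p ^ j) = 0.
  rewrite exprDn_pchar; last by rewrite pnatX; apply/orP; left; rewrite pnatE.
  rewrite x1 exprNn expr1n mulr1; case: (eqVneq p 2%N) => [p2|p2].
    have -> : -1 = 1 :> F.
      apply/eqP; rewrite -subr_eq0 -opprD oppr_eq0 -[1 + 1]/(2%:R).
      by rewrite -p2 (pcharf0 hp).
    by rewrite expr1n -[1 + 1]/(2%:R) -p2 (pcharf0 hp).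
  rewrite -signr_odd oddX orbC; have -> : odd p.
    by case: (even_prime p_pr) => // /eqP; rewrite (negPf p2).
  by rewrite expr1 subrr.
by rewrite expf_eq0 => /andP[].
Qed.

End Unipotent.

(** * The big cell of the general linear group *)

Section LDU.
Variable P : closedFieldType.

Definition lowuni k (L : 'M[P]_k) := forall i j : 'I_k, (i <= j)%N -> L i j = (i == j)%:R.
Definition upuni k (U : 'M[P]_k) := forall i j : 'I_k, (j <= i)%N -> U i j = (i == j)%:R.

Definition LDU k (A : 'M[P]_k) := exists L (d : 'I_k -> P) U,
  [/\ lowuni L, upuni U, forall i, d i != 0 & A = L *m diag_mx (\row_i d i) *m U].

(* The leading minors are nonzero at [s], hence generically; the induction uses
   the Schur complement, multiplied by the pivot to keep it polynomial. *)
Lemma LDU_generic k (A : 'M[{poly P}]_k) (s : P) :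
  (forall i j : 'I_k, (j < i)%N -> (A i j).[s] = 0) ->
  (forall i, (A i i).[s] != 0) ->
  exists2 Q : {poly P}, Q != 0 &
    forall r, Q.[r] != 0 -> LDU (map_mx (horner_eval r) A).
Proof.
elim: k A => [|k IH] A Aup Adiag.
  exists 1; rewrite ?oner_eq0 // => r _; exists 0, (fun=> 0), 0.
  by split; [move=> [] | move=> [] | case | apply/matrixP; case].
pose B := (A : 'M_(1 + k, 1 + k)).
pose a := A 0 0; pose b := ursubmx B; pose c := dlsubmx B; pose D := drsubmx B.
have c0 i j : (c i j).[s] = 0 by rewrite !mxE Aup // ord1.
have DE i j : D i j = A (lift 0 i) (lift 0 j) by rewrite !mxE !rshift1.
have aN0 : a.[s] != 0 := Adiag 0.
have SE i j : ((a *: D - c *m b) i j).[s] = a.[s] * (A (lift 0 i) (lift 0 j)).[s].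
  rewrite mxE [(a *: D) i j]mxE [(- (c *m b)) i j]mxE [(c *m b) i j]mxE big_ord1.
  by rewrite hornerD hornerN !hornerM c0 mul0r subr0 DE.
have [i j ji|i|Q Q0 QP] := IH (a *: D - c *m b).
- by rewrite SE Aup ?mulr0 // !lift0.
- by rewrite SE mulf_neq0.
have a0 : a != 0 by apply: contraNneq aN0 => ->; rewrite horner0.
exists (a * Q); first by rewrite mulf_neq0.
move=> r; rewrite hornerM mulf_eq0 negb_or => /andP[ar Qr].
have [L [d [U [hL hU hd hS]]]] := QP r Qr.
pose h := horner_eval r.
pose cr := map_mx h c; pose br := map_mx h b; pose Dr := map_mx h D.
have hSr : a.[r] *: Dr - cr *m br = L *m diag_mx (\row_i d i) *m U.
  by rewrite -hS map_mxB map_mxM map_mxZ.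
change (@LDU (1 + k) (map_mx h B)).
exists (block_mx 1%:M 0 ((a.[r])^-1 *: cr) L : 'M_(1 + k)).
(* The recursion was applied to [a] times the Schur complement, so its pivots are divided by [a.[r]]
   again. *)
pose e (i : 'I_(1 + k)) := if split i is inr j then d j / a.[r] else a.[r].
exists e.
exists (block_mx 1%:M ((a.[r])^-1 *: br) 0 U : 'M_(1 + k)).
have el i : e (lshift k i) = a.[r] by rewrite /e (unsplitK (inl i)).
have er i : e (rshift 1 i) = d i / a.[r] by rewrite /e (unsplitK (inr i)).
split.
- move=> i j; case: (split_ordP (i : 'I_(1 + k))) => i' ->; case: (split_ordP (j : 'I_(1 + k))) => j' -> /=.
  + by move=> _; rewrite block_mxEul mxE eq_lshift.
  + by move=> _; rewrite block_mxEur mxE eq_lrshift.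
  + by rewrite ord1 leqn0.
  + by rewrite leq_add2l => ij; rewrite block_mxEdr hL // eq_rshift.
- move=> i j; case: (split_ordP (i : 'I_(1 + k))) => i' ->; case: (split_ordP (j : 'I_(1 + k))) => j' -> /=.
  + by move=> _; rewrite block_mxEul mxE eq_lshift.
  + by rewrite ord1 leqn0.
  + by move=> _; rewrite block_mxEdl mxE eq_rlshift.
  + by rewrite leq_add2l => ij; rewrite block_mxEdr hU // eq_rshift.
- by move=> i; rewrite /e; case: split => // j; rewrite mulf_neq0 ?invr_neq0.
have dE : diag_mx (\row_i e i)
  = block_mx (a.[r])%:M 0 0 ((a.[r])^-1 *: diag_mx (\row_i d i)) :> 'M_(1 + k).
  apply/matrixP=> i j; rewrite [LHS]mxE [X in X *+ _]mxE.
  case: (split_ordP (i : 'I_(1 + k))) => i' ->; case: (split_ordP (j : 'I_(1 + k))) => j' -> /=.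
  + by rewrite block_mxEul mxE eq_lshift el.
  + by rewrite block_mxEur mxE eq_lrshift.
  + by rewrite block_mxEdl mxE eq_rlshift.
  + by rewrite block_mxEdr !mxE eq_rshift er mulrC mulrnAr.
rewrite dE !mulmx_block !(mul1mx, mul0mx, mulmx0, addr0, add0r, mulmx1).
have -> : map_mx h B = block_mx (a.[r])%:M br cr Dr :> 'M_(1 + k).
  rewrite -[B]submxK map_block_mx; congr block_mx.
  by apply/matrixP=> i j; rewrite !ord1 !mxE eqxx !lshift0.
congr block_mx.
- by rewrite mul_scalar_mx scalerA divff ?scale1r.
- by rewrite mul_mx_scalar scalerA divff ?scale1r.
rewrite mul_mx_scalar scalerA divff // scale1r -scalemxAr.
rewrite -scalemxAr -scalemxAl -scalerDr -hSr addrC subrK scalerA mulVf ?scale1r //.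
Qed.

(* [Y] is taken on the line through [1] and [A]: at the first end [Y = 1], at
   the second [A *m \adj Y] is scalar. *)
Lemma unitmx_LDU_mul k (A : 'M[P]_k) : A \in unitmx ->
  exists X Y, [/\ LDU X, LDU Y & A = X *m Y].
Proof.
move=> Au; have dA : \det A != 0 by rewrite -unitfE -unitmxE.
pose Y : 'M[{poly P}]_k := 1%:M + 'X *: map_mx polyC (A - 1%:M).
have Yr r : map_mx (horner_eval r) Y = 1%:M + r *: (A - 1%:M).
  rewrite /Y map_mxD map_mx1 map_mxZ /= /horner_eval hornerX -map_mx_comp.
  by congr (_ + _ *: _); apply/matrixP=> i j; rewrite mxE /= hornerC.
pose Z := map_mx polyC A *m \adj Y.
have Zr r : map_mx (horner_eval r) Z = A *m \adj (1%:M + r *: (A - 1%:M)).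
  rewrite map_mxM map_mx_adj Yr -map_mx_comp; congr (_ *m _).
  by apply/matrixP=> i j; rewrite mxE /= /horner_eval hornerC.
have [i j|i|Q1 Q10 Q1P] := @LDU_generic k Y 0.
- move=> ji; have := congr1 (fun M : 'M_k => M i j) (Yr 0).
  by rewrite scale0r addr0 !mxE /horner_eval => ->; case: eqP ji => // ->; rewrite ltnn.
- have := congr1 (fun M : 'M_k => M i i) (Yr 0).
  by rewrite scale0r addr0 !mxE /horner_eval => ->; rewrite eqxx oner_eq0.
have Z1 : map_mx (horner_eval 1) Z = (\det A)%:M.
  by rewrite Zr scale1r addrC subrK mul_mx_adj.
have [i j|i|Q2 Q20 Q2P] := @LDU_generic k Z 1.
- move=> ji; have := congr1 (fun M : 'M_k => M i j) Z1.
  by rewrite [LHS]mxE => E; rewrite -[_.[1]]/(horner_eval 1 _) E mxE; case: eqP ji => // ->; rewrite ltnn.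
- have := congr1 (fun M : 'M_k => M i i) Z1.
  by rewrite [LHS]mxE => E; rewrite -[_.[1]]/(horner_eval 1 _) E mxE eqxx.
have dY : \det Y != 0.
  apply: contraNneq dA => dY0.
  have: horner_eval 1 (\det Y) = 0 by rewrite dY0 /horner_eval horner0.
  by rewrite -det_map_mx Yr scale1r addrC subrK => ->.
have [r] := @generic_point P (Q1 * Q2 * \det Y) (mulf_neq0 (mulf_neq0 Q10 Q20) dY).
rewrite !hornerM !mulf_eq0 !negb_or => /andP[/andP[/Q1P hY /Q2P hZ] dYr].
pose y := map_mx (horner_eval r) Y; pose z := map_mx (horner_eval r) Z.
have dy : \det y = (\det Y).[r] by rewrite det_map_mx.
exists ((\det y)^-1 *: z), y; split=> //.
  have [L [d [U [hL hU hd hS]]]] := hZ.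
  exists L, (fun i => (\det y)^-1 * d i), U; split=> // [i|].
    by rewrite mulf_neq0 ?invr_neq0 // dy.
  rewrite /z hS; have -> : \row_i ((\det y)^-1 * d i) = (\det y)^-1 *: \row_i d i.
    by apply/matrixP=> i j; rewrite !mxE.
  by rewrite linearZ /= -scalemxAr -scalemxAl.
rewrite -scalemxAl /z Zr -Yr -/y -mulmxA mul_adj_mx mul_mx_scalar scalerA mulVf.
  by rewrite scale1r.
by rewrite dy.
Qed.

End LDU.

(** * Generation of the symplectic group *)

Section Symplectic.
Variables (P : closedFieldType) (n : nat).
Implicit Types g h u l : 'M[P]_(n + n).
Local Notation J := (Jform P n).

Lemma Jform_sqr : J *m J = - 1%:M.
Proof.
rewrite mulmx_block !(mul0mx, mulmx0, mul1mx, mulmx1, addr0, add0r).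
by rewrite (scalar_mx_block n n) opp_block_mx !oppr0.
Qed.

Lemma Jform_skew a b : J b a = - J a b.
Proof.
case: (split_ordP a) => i ->; case: (split_ordP b) => j ->.
- by rewrite !block_mxEul !mxE oppr0.
- by rewrite block_mxEdl block_mxEur !mxE eq_sym.
- by rewrite block_mxEdl block_mxEur !mxE opprK eq_sym.
- by rewrite !block_mxEdr !mxE oppr0.
Qed.

Lemma inSp1 : inSp (1%:M : 'M[P]_(n + n)).
Proof. by rewrite /inSp trmx1 mul1mx mulmx1. Qed.

Lemma inSpM g h : inSp g -> inSp h -> inSp (g *m h).
Proof.
by rewrite /inSp => hg hh; rewrite trmx_mul -{2}hh -{2}hg !mulmxA.
Qed.

Lemma inSp_mulVmx g : inSp g -> (- (J *m g^T *m J)) *m g = 1%:M.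
Proof. by move=> hg; rewrite mulNmx -!mulmxA (mulmxA g^T) hg Jform_sqr opprK. Qed.

Lemma inSp_unit g : inSp g -> g \in unitmx.
Proof. by move/inSp_mulVmx/mulmx1_unit => []. Qed.

Lemma inSp_tr g : inSp g -> g *m J *m g^T = J.
Proof.
move=> hg; have := mulmx1C (inSp_mulVmx hg).
rewrite mulmxN => /(congr1 (fun A => A *m J)).
rewrite mulNmx mul1mx -!mulmxA Jform_sqr !mulmxN mulmx1 opprK.
by rewrite mulmxA.
Qed.

Lemma inSp_blockP (A B C D : 'M[P]_n) : inSp (block_mx A B C D) <->
  [/\ A^T *m C = C^T *m A, A^T *m D - C^T *m B = 1%:M & B^T *m D = D^T *m B].
Proof.
rewrite /inSp tr_block_mx !mulmx_block.
rewrite !(mul0mx, mulmx0, mul1mx, mulmx1, mulmxN, mulNmx, addr0, add0r).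
split=> [/eq_block_mx [/eqP h1 h2 _ /eqP h4]|[h1 h2 h3]].
  split; first by apply/eqP; rewrite -subr_eq0 addrC.
    by rewrite addrC.
  by apply/eqP; rewrite -subr_eq0 addrC.
congr block_mx; first by rewrite h1 addNr.
- by rewrite addrC.
- have := congr1 trmx h2.
  rewrite linearB /= !trmx_mul !trmxK trmx1 => <-.
  by rewrite opprB addrC.
- by rewrite h3 addNr.
Qed.

(** [levi] parametrizes the Levi factor of the Siegel parabolic; for symmetric [S], [nup] and [ndn]
    parametrize its unipotent radical and the opposite one. *)
Definition levi (A : 'M[P]_n) : 'M[P]_(n + n) := block_mx A 0 0 (invmx A)^T.
Definition nup (S : 'M[P]_n) : 'M[P]_(n + n) := block_mx 1%:M S 0 1%:M.
Definition ndn (S : 'M[P]_n) : 'M[P]_(n + n) := block_mx 1%:M 0 S 1%:M.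

Lemma inSp_levi A : A \in unitmx -> inSp (levi A).
Proof.
move=> Au; apply/inSp_blockP; rewrite !(trmx0, mul0mx, mulmx0) subr0; split=> //.
by rewrite -trmx_mul mulVmx // trmx1.
Qed.

Lemma inSp_nup S : S^T = S -> inSp (nup S).
Proof.
move=> hS; apply/inSp_blockP.
by rewrite !(trmx0, trmx1, mul0mx, mulmx0, mul1mx, mulmx1) subr0 hS.
Qed.

Lemma inSp_ndn S : S^T = S -> inSp (ndn S).
Proof.
move=> hS; apply/inSp_blockP.
by rewrite !(trmx0, trmx1, mul0mx, mulmx0, mul1mx, mulmx1) subr0 hS.
Qed.

Lemma leviM A B : A \in unitmx -> B \in unitmx -> levi (A *m B) = levi A *m levi B.
Proof.
move=> Au Bu; rewrite mulmx_block !(mul0mx, mulmx0, addr0, add0r).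
congr block_mx; rewrite -trmx_mul; congr trmx.
have ABu : A *m B \in unitmx by rewrite unitmx_mul Au.
apply: (can_inj (mulKmx ABu)); rewrite mulmxV // mulmxA -(mulmxA A) mulmxV //.
by rewrite mulmx1 mulmxV.
Qed.

Lemma levi_diag (d : 'I_n -> P) : (forall i, d i != 0) ->
  levi (diag_mx (\row_i d i)) = torus_elt d.
Proof.
move=> hd; rewrite /levi /torus_elt; congr block_mx.
rewrite -[RHS]tr_diag_mx; congr trmx.
have VE : diag_mx (\row_i (d i)^-1) *m diag_mx (\row_i d i) = 1%:M.
  rewrite mulmx_diag; apply/matrixP=> i j; rewrite !mxE mulVf //.
have [u1 u2] := mulmx1_unit VE.
by rewrite -[LHS]mul1mx -VE -mulmxA mulmxV // mulmx1.
Qed.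

Lemma inSp_torus (t : 'I_n -> P) : (forall i, t i != 0) -> inSp (torus_elt t).
Proof.
move=> ht; rewrite -levi_diag //; apply: inSp_levi.
by rewrite unitmxE det_diag unitfE; apply/prodf_neq0 => i _; rewrite mxE.
Qed.

(** Block elimination with [S = C A^-1] and [T = A^-1 B]. Symmetry of [S] comes from the relation
    for [g^T J g], that of [T] from the one for [g J g^T]. *)
Lemma inSp_gauss g (A := ulsubmx g) : inSp g -> A \in unitmx ->
  exists S T, [/\ S^T = S, T^T = T & g = ndn S *m levi A *m nup T].
Proof.
move=> hg Au; pose B := ursubmx g; pose C := dlsubmx g; pose D := drsubmx g.
have gE : g = block_mx A B C D by rewrite submxK.
have := hg; rewrite gE => /inSp_blockP [h1 h2 _].
have AuT : A^T \in unitmx by rewrite unitmx_tr.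
have h1' : (C *m invmx A)^T = C *m invmx A.
  apply: (can_inj (mulmxK Au)); rewrite mulmxKV //.
  apply: (can_inj (mulKmx AuT)).
  by rewrite mulmxA -trmx_mul mulmxKV // -h1.
have : ulsubmx (g *m J *m g^T) = ulsubmx J by rewrite inSp_tr.
rewrite gE tr_block_mx !mulmx_block !block_mxKul.
rewrite !(mul0mx, mulmx0, mul1mx, mulmx1, mulmxN, mulNmx, addr0, add0r).
rewrite addrC => /eqP; rewrite subr_eq0 => /eqP h4.
exists (C *m invmx A), (invmx A *m B); split=> //.
  apply: (can_inj (mulmxK AuT)); apply: (can_inj (mulKmx Au)).
  by rewrite -trmx_mul mulKVmx // h4 !mulmxA mulmxV // mul1mx.
rewrite /ndn /levi /nup !mulmx_block.
rewrite !(mul0mx, mulmx0, mul1mx, mulmx1, addr0, add0r) mulmxKV // mulKVmx //.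
congr block_mx; apply: (can_inj (mulKmx AuT)).
rewrite mulmxDr mulmxA h1 -mulmxA mulKVmx // -trmx_mul mulVmx // trmx1.
by rewrite -h2 addrC subrK.
Qed.

(* The left kernel of [A + B S] is that of [row_mx A B]: here [S] is the form
   [copid_mx], moved by the row operations which bring [A] to rank normal form. *)
Lemma inSp_ulsubmx_unit g : inSp g ->
  exists S, S^T = S /\ ulsubmx (g *m ndn S) \in unitmx.
Proof.
move=> hg; pose A := ulsubmx g; pose B := ursubmx g.
have gE : g = block_mx A B (dlsubmx g) (drsubmx g) by rewrite submxK.
have : ulsubmx (g *m J *m g^T) = ulsubmx J by rewrite inSp_tr.
rewrite {1 2}gE tr_block_mx !mulmx_block !block_mxKul.
rewrite !(mul0mx, mulmx0, mul1mx, mulmx1, mulmxN, mulNmx, addr0, add0r).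
rewrite addrC => /eqP; rewrite subr_eq0 => /eqP h4.
pose X := col_ebase A; pose Y := row_ebase A; pose r : nat := \rank A.
have AE : A = X *m pid_mx r *m Y by rewrite mulmx_ebase.
have Yu : Y \in unitmx := row_ebase_unit A.
have Xu : X \in unitmx := col_ebase_unit A.
have rn : (r <= n)%N := rank_leq_row A.
pose c : 'M[P]_n := copid_mx r.
have cT : c^T = c by rewrite /c /copid_mx linearB /= trmx1 tr_pid_mx.
exists (Y^T *m c *m Y); split; first by rewrite !trmx_mul trmxK cT mulmxA.
rewrite [in ulsubmx _]gE mulmx_block block_mxKul mulmx1 -row_free_unit.
apply/row_freeP; apply/row_freeP; rewrite -kermx_eq0; apply/eqP/row_matrixP => i.
rewrite row0; set u := row i _.
have : u *m (A + B *m (Y^T *m c *m Y)) = 0.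
  by apply/eqP; rewrite -sub_kermx row_sub.
rewrite mulmxDr {1}AE !mulmxA -mulmxDl => /(congr1 (fun M => M *m invmx Y)).
rewrite mul0mx mulmxK // => h5.
have h6 : u *m X *m (pid_mx r : 'M_n) = 0.
  have := congr1 (fun M => M *m (pid_mx r : 'M_n)) h5; rewrite /= mul0mx mulmxDl.
  by rewrite -!mulmxA mul_copid_mx_pid // !mulmx0 addr0 pid_mx_id.
have uA : u *m A = 0 by rewrite AE !mulmxA h6 mul0mx.
have h7 : u *m B *m Y^T *m c = 0 by move: h5; rewrite h6 add0r.
(* The last columns of [u *m B *m Y^T] vanish by [h7]; the first [r] vanish because
   [u *m B *m A^T = u *m A *m B^T = 0]. *)
have h8 : u *m B *m Y^T *m (pid_mx r : 'M_n) = 0.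
  have : u *m B *m A^T = 0 by rewrite -mulmxA -h4 mulmxA uA mul0mx.
  rewrite AE !trmx_mul tr_pid_mx !mulmxA => /(congr1 (fun M => M *m invmx X^T)).
  by rewrite mul0mx mulmxK // unitmx_tr.
have uB : u *m B = 0.
  have : u *m B *m Y^T = 0.
    by rewrite -[LHS]mulmx1 -(subrK (pid_mx r) 1%:M) mulmxDr h7 h8 addr0.
  by move/(congr1 (fun M => M *m invmx Y^T)); rewrite mul0mx mulmxK // unitmx_tr.
have : row_mx u 0 *m g = 0.
  by rewrite gE mul_row_block !mul0mx !addr0 uA uB row_mx0.
move/(congr1 (fun M => M *m invmx g)); rewrite mul0mx mulmxK ?inSp_unit //.
by move/(congr1 lsubmx); rewrite row_mxKl linear0.
Qed.

End Symplectic.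

(** * Unitriangular matrices *)

Section UnitriangularInverse.
Variable P : closedFieldType.

(** Forward substitution: row [i] of the inverse is determined by the rows above it. *)
Lemma lowuni_inv k (L M : 'M[P]_k) : lowuni L -> L *m M = 1%:M -> lowuni M.
Proof.
move=> hL LM i j; have [m] := ubnP i; elim: m i => // m IH i im ij.
have /matrixP/(_ i j) := LM; rewrite !mxE (bigD1 i) //= hL // eqxx mul1r.
rewrite big1 ?addr0 // => l li.
have [il|li'] := leqP i l; first by rewrite hL // eq_sym (negPf li) mul0r.
rewrite IH ?(leq_trans li') ?(leq_trans (ltnW li')) //.
by rewrite -val_eqE ltn_eqF ?mulr0 // (leq_trans li').
Qed.

Lemma upuni_tr k (U : 'M[P]_k) : upuni U -> lowuni U^T.
Proof. by move=> hU i j ij; rewrite mxE hU // eq_sym. Qed.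

Lemma lowuni_unit k (L : 'M[P]_k) : lowuni L -> L \in unitmx.
Proof.
move=> hL; rewrite unitmxE det_trig.
  by rewrite big1 ?unitr1 // => i _; rewrite hL // eqxx.
apply/is_trig_mxP => i j ij; rewrite hL 1?ltnW //.
by rewrite -val_eqE ltn_eqF.
Qed.

Lemma upuni_unit k (U : 'M[P]_k) : upuni U -> U \in unitmx.
Proof. by move/upuni_tr/lowuni_unit; rewrite unitmx_tr. Qed.

End UnitriangularInverse.

(** * The big cell of the symplectic group and its contracting torus *)

Section Grading.
Variables (P : closedFieldType) (n : nat).
Implicit Types g h u l : 'M[P]_(n + n).

(* The exponents of the regular dominant one-parameter subgroup [tau]. *)
Definition gr (a : 'I_(n + n)) : int :=
  match split a with inl i => (n - i)%:Z | inr i => - (n - i)%:Z end.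

Lemma gr_lshift (i : 'I_n) : gr (lshift n i) = (n - i)%:Z.
Proof. by rewrite /gr (unsplitK (inl i)). Qed.

Lemma gr_rshift (i : 'I_n) : gr (rshift n i) = - (n - i)%:Z.
Proof. by rewrite /gr (unsplitK (inr i)). Qed.

Lemma gr_lshift_gt0 (i : 'I_n) : 0 < gr (lshift n i).
Proof. by rewrite gr_lshift ltz_nat subn_gt0. Qed.

Lemma gr_rshift_lt0 (i : 'I_n) : gr (rshift n i) < 0.
Proof. by rewrite gr_rshift oppr_lt0 ltz_nat subn_gt0. Qed.

Lemma gr_llE (i j : 'I_n) : (gr (lshift n i) <= gr (lshift n j)) = (j <= i)%N.
Proof. by rewrite !gr_lshift lez_nat leq_sub2lE // ltnW. Qed.

Lemma gr_rrE (i j : 'I_n) : (gr (rshift n i) <= gr (rshift n j)) = (i <= j)%N.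
Proof. by rewrite !gr_rshift lerN2 lez_nat leq_sub2lE // ltnW. Qed.

Lemma gr_inj : injective gr.
Proof.
move=> a b; case: (split_ordP a) => i ->; case: (split_ordP b) => j -> E.
- by congr lshift; apply/val_inj/eqP; rewrite eqn_leq -!gr_llE E lexx.
- by have := gr_lshift_gt0 i; rewrite E ltNge ltW // gr_rshift_lt0.
- by have := gr_lshift_gt0 j; rewrite -E ltNge ltW // gr_rshift_lt0.
- by congr rshift; apply/val_inj/eqP; rewrite eqn_leq -!gr_rrE E lexx.
Qed.

(** Unitriangularity in the basis ordered by decreasing [gr], so that the symplectic matrices of
    this form are the unipotent radical of a Borel subgroup. In the block order the lower right
    block has the opposite triangularity. *)
Definition uptri u := forall a b, gr a <= gr b -> u a b = (a == b)%:R.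
Definition dntri l := uptri l^T.

Lemma uptriM u v : uptri u -> uptri v -> uptri (u *m v).
Proof.
move=> hu hv a b ab; rewrite mxE (bigD1 a) //= hu // eqxx mul1r hv //.
rewrite big1 ?addr0 // => c ca.
have [ac|ca'] := leP (gr a) (gr c); first by rewrite hu // eq_sym (negPf ca) mul0r.
by rewrite hv ?(le_trans (ltW ca')) //; case: eqP ca' ab => [->|]; rewrite ?mulr0 // ltNge => /negPf ->.
Qed.

Lemma dntriM u v : dntri u -> dntri v -> dntri (u *m v).
Proof. by rewrite /dntri trmx_mul => hu hv; apply: uptriM. Qed.

Lemma uptri_nup (S : 'M[P]_n) : uptri (nup S).
Proof.
move=> a b; case: (split_ordP a) => i ->; case: (split_ordP b) => j ->.
- by move=> _; rewrite block_mxEul mxE eq_lshift.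
- by rewrite leNgt (lt_trans (gr_rshift_lt0 _) (gr_lshift_gt0 _)).
- by move=> _; rewrite block_mxEdl mxE eq_rlshift.
- by move=> _; rewrite block_mxEdr mxE eq_rshift.
Qed.

Lemma dntri_ndn (S : 'M[P]_n) : dntri (ndn S).
Proof. by rewrite /dntri tr_block_mx !trmx1 trmx0; apply: uptri_nup. Qed.

Lemma uptri_levi (U : 'M[P]_n) : upuni U -> uptri (levi U).
Proof.
move=> hU a b; case: (split_ordP a) => i ->; case: (split_ordP b) => j ->.
- by rewrite gr_llE => ij; rewrite block_mxEul hU // eq_lshift.
- by rewrite leNgt (lt_trans (gr_rshift_lt0 _) (gr_lshift_gt0 _)).
- by move=> _; rewrite block_mxEdl mxE eq_rlshift.
- rewrite gr_rrE => ij; rewrite block_mxEdr eq_rshift.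
  apply: lowuni_inv (upuni_tr hU) _ _ _ ij.
  by rewrite -trmx_mul mulVmx ?upuni_unit // trmx1.
Qed.

Lemma dntri_levi (L : 'M[P]_n) : lowuni L -> dntri (levi L).
Proof.
move=> hL a b; rewrite mxE; case: (split_ordP a) => i ->; case: (split_ordP b) => j ->.
- by rewrite gr_llE => ij; rewrite block_mxEul hL // eq_lshift eq_sym.
- by rewrite leNgt (lt_trans (gr_rshift_lt0 _) (gr_lshift_gt0 _)).
- by move=> _; rewrite block_mxEur mxE eq_rlshift.
- rewrite gr_rrE => ij; rewrite block_mxEdr eq_rshift mxE.
  by apply: (lowuni_inv hL) ij; rewrite mulmxV ?lowuni_unit.
Qed.

(* The big cell. *)
Definition Gauss g := exists l t u, [/\ inSp l /\ dntri l, inSp u /\ uptri u,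
  forall i, t i != 0 & g = l *m torus_elt t *m u].

(** Only the upper left block matters: once it is [L d U], block elimination splits [g], and [levi]
    carries the three factors into the torus and the two unipotent groups. *)
Lemma Gauss_LDU g : inSp g -> LDU (ulsubmx g) -> Gauss g.
Proof.
move=> hg [L [d [U [hL hU hd AE]]]].
have Lu := lowuni_unit hL; have Uu := upuni_unit hU.
have du : diag_mx (\row_i d i) \in unitmx.
  by rewrite unitmxE det_diag unitfE; apply/prodf_neq0 => i _; rewrite mxE.
have Au : ulsubmx g \in unitmx by rewrite AE !unitmx_mul Lu du Uu.
have [S [T [hS hT gE]]] := inSp_gauss hg Au.
exists (ndn S *m levi L), d, (levi U *m nup T); split=> //.
- split; first by apply: inSpM; [apply: inSp_ndn | apply: inSp_levi].
  by apply: dntriM; [apply: dntri_ndn | apply: dntri_levi].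
- split; first by apply: inSpM; [apply: inSp_levi | apply: inSp_nup].
  by apply: uptriM; [apply: uptri_levi | apply: uptri_nup].
by rewrite gE AE !leviM ?unitmx_mul ?Lu // levi_diag // !mulmxA.
Qed.

Lemma ndn_inv (S : 'M[P]_n) : ndn S *m ndn (- S) = 1%:M.
Proof.
rewrite mulmx_block !(mul0mx, mulmx0, mul1mx, mulmx1, addr0, add0r) subrr.
by rewrite (scalar_mx_block n n).
Qed.

Lemma ulsubmx_mul_levi g (A : 'M[P]_n) : ulsubmx (g *m levi A) = ulsubmx g *m A.
Proof. by rewrite -{1}[g]submxK mulmx_block block_mxKul mulmx0 addr0. Qed.

(** Once [ndn S] has made the upper left block invertible, that block is a product [X Y] of two
    elements of the big cell of the general linear group. Splitting at [levi Y] gives factors whose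
    upper left blocks are [X] and [Y]. *)
Lemma inSp_Gauss_mul g : inSp g -> exists g1 g2,
  [/\ inSp g1, inSp g2, Gauss g1, Gauss g2 & g = g1 *m g2].
Proof.
move=> hg; have [S [hS Au]] := inSp_ulsubmx_unit hg.
have [X [Y [hX hY AE]]] := unitmx_LDU_mul Au.
have [Xu Yu] : X \in unitmx /\ Y \in unitmx.
  by apply/andP; rewrite -unitmx_mul -AE.
have hS' : (- S)^T = - S by rewrite linearN /= hS.
have YVu : invmx Y \in unitmx by rewrite unitmx_inv.
have h2 : inSp (levi Y *m ndn (- S)).
  by apply: inSpM; [apply: inSp_levi | apply: inSp_ndn].
have h1 : inSp (g *m ndn S *m levi (invmx Y)).
  by rewrite -mulmxA; apply: inSpM => //; apply: inSpM; [apply: inSp_ndn | apply: inSp_levi].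
exists (g *m ndn S *m levi (invmx Y)), (levi Y *m ndn (- S)); split=> //.
- by apply: Gauss_LDU; rewrite // ulsubmx_mul_levi AE mulmxK.
- apply: Gauss_LDU; rewrite // mulmx_block block_mxKul mulmx1 mul0mx addr0 //.
rewrite !mulmxA -(mulmxA _ (levi _) (levi _)) -leviM // mulVmx //.
have -> : levi 1%:M = 1%:M :> 'M[P]_(n + n).
  by rewrite /levi invmx1 trmx1 (scalar_mx_block n n).
by rewrite mulmx1 -mulmxA ndn_inv mulmx1.
Qed.

Definition tau (r : P) : 'M[P]_(n + n) := torus_elt (fun i : 'I_n => r ^+ (n - i)).

Lemma tauE r a b : tau r a b = (a == b)%:R * r ^ (gr a).
Proof.
case: (split_ordP a) => i ->; case: (split_ordP b) => j ->.
- by rewrite block_mxEul !mxE eq_lshift gr_lshift mulr_natl.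
- by rewrite block_mxEur !mxE eq_lrshift mul0r.
- by rewrite block_mxEdl !mxE eq_rlshift mul0r.
- by rewrite block_mxEdr !mxE eq_rshift gr_rshift mulr_natl exprnN.
Qed.

Lemma inSp_tau r : r != 0 -> inSp (tau r).
Proof. by move=> r0; apply: inSp_torus => i; rewrite expf_neq0. Qed.

Lemma tau1 : tau 1 = 1%:M.
Proof. by apply/matrixP=> a b; rewrite tauE mxE exp1rz mulr1. Qed.

Lemma tauM r s : tau (r * s) = tau r *m tau s.
Proof.
apply/matrixP=> a b; rewrite tauE [RHS]mxE (bigD1 a) //= big1 ?addr0.
  by rewrite !tauE eqxx mul1r mulrCA expfzMl.
by move=> c ca; rewrite tauE eq_sym (negPf ca) !mul0r.
Qed.

(* [curve u r] is [tau r *m u *m tau r^-1] for [u] upper, [tau r^-1 *m u *m tau r]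
   for [u] lower unitriangular; it extends by [1] to [r = 0]. *)
Definition curvep g : 'M[{poly P}]_(n + n) :=
  \matrix_(a, b) ((g a b)%:P * 'X ^+ `|gr a - gr b|%N).
Definition curve g r := map_mx (horner_eval r) (curvep g).

Lemma curveE g r a b : curve g r a b = g a b * r ^+ `|gr a - gr b|%N.
Proof. by rewrite !mxE /horner_eval !hornerE. Qed.

Lemma curve_up u r : r != 0 -> uptri u -> curve u r *m tau r = tau r *m u.
Proof.
move=> r0 hu; apply/matrixP=> a b.
rewrite [LHS]mxE [RHS]mxE (bigD1 b) //= [in RHS](bigD1 a) //= !big1 ?addr0; last 2 first.
- by move=> c ca; rewrite tauE eq_sym (negPf ca) !mul0r.
- by move=> c cb; rewrite tauE (negPf cb) mul0r mulr0.
rewrite curveE !tauE !eqxx !mul1r -mulrA [RHS]mulrC.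
have [ba|ab] := leP (gr b) (gr a).
  by rewrite exprnP gez0_abs ?subr_ge0 // -expfzDr // subrK.
rewrite hu ?(ltW ab) //; case: eqP ab => [->|]; first by rewrite ltxx.
by rewrite !mul0r.
Qed.

Lemma curve_tr g r : curve g^T r = (curve g r)^T.
Proof. by apply/matrixP=> a b; rewrite [RHS]mxE !curveE mxE -abszN opprB. Qed.

Lemma tr_tau r : (tau r)^T = tau r.
Proof.
apply/matrixP=> a b; rewrite [LHS]mxE !tauE eq_sym.
by case: eqP => [->|] //; rewrite !mul0r.
Qed.

Lemma curve_dn l r : r != 0 -> dntri l -> tau r *m curve l r = l *m tau r.
Proof.
move=> r0 hl; apply: trmx_inj; rewrite !trmx_mul tr_tau -curve_tr.
exact: curve_up.
Qed.

Lemma curve0_up u : uptri u -> curve u 0 = 1%:M.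
Proof.
move=> hu; apply/matrixP=> a b; rewrite curveE expr0n absz_eq0 subr_eq0.
rewrite (inj_eq gr_inj) mxE; case: eqP => [->|_]; last by rewrite mulr0.
by rewrite hu // eqxx mulr1.
Qed.

Lemma curve0_dn l : dntri l -> curve l 0 = 1%:M.
Proof. by move=> hl; rewrite -[l]trmxK curve_tr curve0_up // trmx1. Qed.

Lemma tauV r : r != 0 -> tau r *m tau r^-1 = 1%:M.
Proof. by move=> r0; rewrite -tauM divff // tau1. Qed.

Lemma inSp_curve_up u r : inSp u -> uptri u -> inSp (curve u r).
Proof.
move=> hu tu; case: (eqVneq r 0) => [->|r0]; first by rewrite curve0_up //; apply: inSp1.
rewrite -[curve u r]mulmx1 -(tauV r0) mulmxA curve_up //.
by do 2?[apply: inSpM]; rewrite ?invrK //; apply: inSp_tau; rewrite ?invr_neq0.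
Qed.

Lemma inSp_curve_dn l r : inSp l -> dntri l -> inSp (curve l r).
Proof.
move=> hl tl; case: (eqVneq r 0) => [->|r0]; first by rewrite curve0_dn //; apply: inSp1.
rewrite -[curve l r]mul1mx -(tauV (invr_neq0 r0)) invrK -mulmxA curve_dn //.
by do 2?[apply: inSpM]; rewrite ?invrK //; apply: inSp_tau; rewrite ?invr_neq0.
Qed.

(* A point of [U+ * U-] can be moved into the big cell by the torus, since
   [u *m curve l r] tends to [u] when [r] tends to 0. *)
Lemma Gauss_curve u l : inSp u -> uptri u -> inSp l -> dntri l ->
  exists2 Q : {poly P}, Q != 0 & forall r, Q.[r] != 0 -> Gauss (u *m curve l r).
Proof.
move=> hu tu hl tl.
pose A : 'M[{poly P}]_n := ulsubmx (map_mx polyC u *m curvep l).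
have Ar r : map_mx (horner_eval r) A = ulsubmx (u *m curve l r).
  rewrite /A map_ulsubmx map_mxM -map_mx_comp; congr (ulsubmx (_ *m _)).
  by apply/matrixP=> i j; rewrite mxE /= /horner_eval hornerC.
have A0 i j : (A i j).[0] = u (lshift n i) (lshift n j).
  have /matrixP/(_ i j) := Ar 0.
  by rewrite [LHS]mxE curve0_dn // mulmx1 /horner_eval => ->; rewrite !mxE.
have [i j ji|i|Q Q0 QP] := @LDU_generic P n A 0.
- rewrite A0 tu ?gr_llE 1?ltnW // eq_lshift.
  by rewrite -val_eqE eq_sym ltn_eqF.
- by rewrite A0 tu // eqxx oner_eq0.
exists Q => // r Qr; apply: Gauss_LDU; last by rewrite -Ar; apply: QP.
by apply: inSpM => //; apply: inSp_curve_dn.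
Qed.

End Grading.

(** * The truncated Weyl algebra *)

Lemma mnm_ind n (Q : 'X_{1..n} -> Prop) :
  Q 0%MM -> (forall a j, Q a -> Q (a + U_(j))%MM) -> forall a, Q a.
Proof.
move=> Q0 QS a; have [d] := ubnP (mdeg a); elim: d a => // d IH a ad.
case: (eqVneq a 0%MM) => [->//|a0].
have [j aj] : exists j, (0 < a j)%N.
  apply: NNPP => h; case/eqP: a0; apply/mnmP => j; rewrite mnm0E.
  by apply/eqP; rewrite -leqn0 leqNgt; apply/negP => aj; apply: h; exists j.
have aE : (a - U_(j) + U_(j))%MM = a.
  by apply: submK; rewrite lep1mP -lt0n.
rewrite -aE; apply/QS/IH; move: ad; rewrite -{1}aE mdegD mdeg1 addn1.
by rewrite ltnS.
Qed.

Lemma inj_unitmx (F : fieldType) k (S : 'M[F]_k) :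
  (forall y : 'cV_k, S *m y = 0 -> y = 0) -> S \in unitmx.
Proof.
move=> inj; rewrite -unitmx_tr -row_free_unit -kermx_eq0.
apply/eqP/row_matrixP => i; rewrite row0; apply: trmx_inj; rewrite trmx0.
apply: inj; apply: trmx_inj; rewrite trmx_mul trmxK trmx0.
by apply/eqP; rewrite -sub_kermx row_sub.
Qed.

(** Each [D i] in turn is applied as often as possible without killing the vector; commutation keeps
    the earlier ones zero. [Q] is carried along to find the vector inside a stable subspace, such as
    the kernel of an intertwiner. *)
Lemma common_kernel (F : fieldType) (N n q : nat) (D : 'I_n -> 'M[F]_N)
    (Q : 'cV[F]_N -> Prop) (y : 'cV[F]_N) :
  (forall i j, D i *m D j = D j *m D i) -> (forall i, D i ^+ q = 0) ->
  (forall i y, Q y -> Q (D i *m y)) -> y != 0 -> Q y ->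
  exists y, [/\ y != 0, Q y & forall i, D i *m y = 0].
Proof.
move=> Dcomm Dnil QD y0 Qy.
suff main k : (k <= n)%N ->
    exists z, [/\ z != 0, Q z & forall i : 'I_n, (i < k)%N -> D i *m z = 0].
  by have [z [z0 Qz Dz]] := main n (leqnn n); exists z; split=> // i; apply: Dz.
elim: k => [|k IH] kn; first by exists y; split.
have [z [z0 Qz Dz]] := IH (ltnW kn).
pose d := D (Ordinal kn).
have ex : exists j, d ^+ j *m z == 0 by exists q; rewrite Dnil mul0mx.
case: (ex_minnP ex) => -[|j]; first by rewrite expr0 mul1mx (negPf z0).
move=> /eqP dj minj; exists (d ^+ j *m z); split.
- by apply/negP => /minj; rewrite ltnn.
- elim: (j) => [|i IHi]; first by rewrite expr0 mul1mx.
  by rewrite exprS -mulmxA; apply: QD.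
move=> i; rewrite ltnS leq_eqVlt => /orP[/eqP ik|ik].
  by have -> : i = Ordinal kn by [apply: val_inj]; rewrite mulmxA -dj exprS.
rewrite mulmxA; have -> : D i *m d ^+ j = d ^+ j *m D i.
  by apply: commrX; apply: Dcomm.
by rewrite -mulmxA Dz // mulmx0.
Qed.

(** At [k = p] the correction vanishes, which makes p-th powers of the transformed generators
    central. *)
Lemma comm_scalar_exp (F : fieldType) N (A B : 'M[F]_N) (c : F) k :
  A *m B - B *m A = c%:M -> A ^+ k *m B = B *m A ^+ k + (c *+ k) *: A ^+ k.-1.
Proof.
move=> AB; have {}AB : A *m B = B *m A + c%:M by rewrite -AB addrC subrK.
elim: k => [|k IH]; first by rewrite expr0 mulr0n scale0r addr0 mul1mx mulmx1.
rewrite exprS -mulmxA IH mulmxDr mulmxA AB mulmxDl mul_scalar_mx -scalemxAr.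
rewrite -mulmxA -addrA; congr (_ + _); case: k {IH} => [|k].
  by rewrite mulr0n scale0r addr0 mulr1n.
by rewrite /= -[A *m A ^+ k]/(A * A ^+ k) -exprS -scalerDl -mulrS.
Qed.

Section Weyl.
Variables (P : closedFieldType) (p n : nat).
Hypotheses (hchar : p \in [pchar P]) (hp2 : (2 < p)%N).
Local Notation J := (Jform P n).

Let p_gt0 : (0 < p)%N := ltnW (ltnW hp2).
Definition box := {ffun 'I_n -> 'I_p}.
Local Notation N := #|box|.

Definition mnmb (x : box) : 'X_{1..n} := [multinom (x i : nat) | i < n].
Definition inbox (a : 'X_{1..n}) := [forall i, a i < p]%N.
Definition boxm (a : 'X_{1..n}) : box := [ffun i => Ordinal (ltn_pmod (a i) p_gt0)].

Lemma inbox_mnmb x : inbox (mnmb x).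
Proof. by apply/forallP => i; rewrite mnmE. Qed.

Lemma mnmbK x : boxm (mnmb x) = x.
Proof. by apply/ffunP => i; apply: val_inj; rewrite ffunE /= mnmE modn_small. Qed.

Lemma boxmK a : inbox a -> mnmb (boxm a) = a.
Proof.
by move=> /forallP ha; apply/mnmP => i; rewrite mnmE ffunE /= modn_small.
Qed.

(* The monomial x^a; it vanishes outside the box. *)
Definition e a : 'cV[P]_N := if inbox a then delta_mx (enum_rank (boxm a)) 0 else 0.

Definition op k (f : 'X_{1..n} -> 'cV[P]_k) : 'M[P]_(k, N) :=
  \matrix_(i, j) f (mnmb (enum_val j)) i 0.

Lemma mul_mx_e k (A : 'M[P]_(k, N)) a :
  A *m e a = if inbox a then col (enum_rank (boxm a)) A else 0.
Proof. by rewrite /e; case: ifP => _; rewrite ?mulmx0 // colE. Qed.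

Lemma op_e k (f : 'X_{1..n} -> 'cV[P]_k) a : inbox a -> op f *m e a = f a.
Proof.
move=> ha; rewrite mul_mx_e ha; apply/colP => i.
by rewrite !mxE enum_rankK boxmK.
Qed.

Lemma mx_ext k (A B : 'M[P]_(k, N)) :
  (forall a, inbox a -> A *m e a = B *m e a) -> A = B.
Proof.
move=> AB; apply/matrixP => i j.
have /colP/(_ i) := AB _ (inbox_mnmb (enum_val j)).
by rewrite !mul_mx_e inbox_mnmb mnmbK enum_valK !mxE.
Qed.

Lemma e_out a : ~~ inbox a -> e a = 0.
Proof. by rewrite /e => /negPf ->. Qed.

Lemma inboxDl a b : inbox (a + b)%MM -> inbox a.
Proof.
move=> /forallP h; apply/forallP => i; apply: leq_ltn_trans (h i).
by rewrite mnmDE leq_addr.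
Qed.

Lemma inbox0 : inbox 0%MM.
Proof. by apply/forallP => i; rewrite mnm0E. Qed.

Lemma inbox1 j : inbox U_(j)%MM.
Proof. by apply/forallP => i; rewrite mnm1E; apply: leq_ltn_trans (leq_b1 _) (ltnW hp2). Qed.

Definition es a : 'rV[P]_N := (e a)^T.

Lemma es_e a b : inbox b -> es a *m e b = (a == b)%:R%:M.
Proof.
move=> hb; rewrite /es mul_mx_e hb; apply/matrixP => i j.
rewrite !ord1 !mxE eqxx mulr1n /e; case: ifP => ha.
  rewrite mxE eqxx andbT (inj_eq enum_rank_inj); congr ((nat_of_bool _)%:R).
  by apply/idP/idP => [/eqP E|/eqP -> //]; apply/eqP; rewrite -(boxmK ha) -E boxmK.
by rewrite mxE; case: eqP ha => // ->; rewrite hb.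
Qed.

Definition opX i : 'M[P]_N := op (fun a => e (a + U_(i))%MM).
Definition opD i : 'M[P]_N := op (fun a => (a i)%:R *: e (a - U_(i))%MM).
Definition par : 'M[P]_N := op (fun a => (-1) ^+ mdeg a *: e a).

Lemma opX_e i a : opX i *m e a = e (a + U_(i))%MM.
Proof.
have [ha|ha] := boolP (inbox a); first by rewrite op_e.
by rewrite !e_out ?mulmx0 //; apply: contra ha; apply: inboxDl.
Qed.

(** Derivations respect the ideal of the x_j^p: if [a] is outside the box and [a - U_(i)] inside,
    then [a i = p] and the coefficient is zero. *)
Lemma opD_e i a : opD i *m e a = (a i)%:R *: e (a - U_(i))%MM.
Proof.
have [ha|ha] := boolP (inbox a); first by rewrite op_e.
rewrite (e_out ha) mulmx0; have [hb|hb] := boolP (inbox (a - U_(i))%MM).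
  have [j] := forallPn ha; rewrite -leqNgt => pj.
  have := forallP hb j; rewrite mnmBE mnm1E; case: eqP => [->|_].
    rewrite subn1 => lt; have -> : a j = p.
      apply/eqP; rewrite eqn_leq pj andbT; move: lt pj.
      by case: (a j) => [|m] //= _ /(leq_trans p_gt0).
    by rewrite pcharf0 // scale0r.
  by rewrite subn0 ltnNge pj.
by rewrite e_out // scaler0.
Qed.

Lemma par_e a : par *m e a = (-1) ^+ mdeg a *: e a.
Proof.
have [ha|ha] := boolP (inbox a); first by rewrite op_e.
by rewrite e_out // mulmx0 scaler0.
Qed.

(** Derivations stand for the first half of the symplectic basis and multiplications for the second,
    so that [J] is the matrix of commutators. *)
Definition Z (a : 'I_(n + n)) : 'M[P]_N :=
  match split a with inl i => opD i | inr i => opX i end.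

Lemma Z_lshift i : Z (lshift n i) = opD i.
Proof. by rewrite /Z (unsplitK (inl i)). Qed.

Lemma Z_rshift i : Z (rshift n i) = opX i.
Proof. by rewrite /Z (unsplitK (inr i)). Qed.

Lemma opXX i j : opX i *m opX j = opX j *m opX i.
Proof. by apply: mx_ext => a _; rewrite -!mulmxA !opX_e -!addmA [(U_(j) + U_(i))%MM]addmC. Qed.

Lemma mnm_subUC (a : 'X_{1..n}) i j : (a - U_(i) - U_(j) = a - U_(j) - U_(i))%MM.
Proof. by apply/mnmP => k; rewrite !mnmBE subnAC. Qed.

Lemma opDD i j : opD i *m opD j = opD j *m opD i.
Proof.
apply: mx_ext => a _; rewrite -!mulmxA !opD_e -!scalemxAr !opD_e !scalerA mnm_subUC.
rewrite !mnmBE !mnm1E [j == i]eq_sym; case: eqP => [->//|_].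
by rewrite !subn0 mulrC.
Qed.

Lemma opDX i j : opD i *m opX j = opX j *m opD i + ((i == j)%:R)%:M.
Proof.
apply: mx_ext => a _; rewrite mulmxDl -!mulmxA opX_e !opD_e -scalemxAr opX_e.
rewrite mul_scalar_mx mnmDE mnm1E eq_sym; case: eqP => [->|ij].
  rewrite addmK addn1 -natr1 scalerDl scale1r; congr (_ + _).
  by case E: (a j) => [|m]; rewrite ?scale0r // submK // lep1mP E.
rewrite addn0 scale0r addr0; case E: (a i) => [|m]; rewrite ?scale0r //.
congr (_ *: e _); rewrite addmC -addmBA ?lep1mP ?E //; exact: addmC.
Qed.

Lemma Z_comm a b : Z a *m Z b - Z b *m Z a = (J a b)%:M.
Proof.
case: (split_ordP a) => i ->; case: (split_ordP b) => j ->; rewrite ?Z_lshift ?Z_rshift.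
- by rewrite opDD subrr block_mxEul mxE raddf0.
- by rewrite opDX addrAC subrr add0r block_mxEur mxE.
- by rewrite opDX opprD addrA subrr add0r block_mxEdl !mxE eq_sym rmorphN.
- by rewrite opXX subrr block_mxEdr mxE raddf0.
Qed.

Lemma par_Z a : par *m Z a = - (Z a *m par).
Proof.
apply: mx_ext => b hb; rewrite mulNmx -!mulmxA par_e -scalemxAr.
case: (split_ordP a) => i ->; rewrite ?Z_lshift ?Z_rshift.
  rewrite opD_e -scalemxAr par_e !scalerA -scaleNr.
  case E: (b i) => [|m]; first by rewrite !(mul0r, mulr0) oppr0.
  have -> : mdeg b = (mdeg (b - U_(i))%MM).+1.
    by rewrite -addn1 -(mdeg1 i) -mdegD submK // lep1mP E.
  by rewrite exprS mulN1r mulNr opprK mulrC.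
by rewrite opX_e par_e mdegD mdeg1 addn1 exprS mulN1r scaleNr.
Qed.

(* The image of the generator [Z k] under the substitution given by [g]. *)
Definition gZ (g : 'M[P]_(n + n)) k : 'M[P]_N := \sum_l g l k *: Z l.

Lemma gZ1 k : gZ 1%:M k = Z k.
Proof.
rewrite /gZ (bigD1 k) //= big1 => [|l lk]; rewrite mxE ?eqxx ?scale1r ?addr0 //.
by rewrite (negPf lk) scale0r.
Qed.

Lemma gZ_Z g k b : gZ g k *m Z b - Z b *m gZ g k = (\sum_l g l k * J l b)%:M.
Proof.
rewrite /gZ mulmx_suml mulmx_sumr -sumrB rmorph_sum /=; apply: eq_bigr => l _.
by rewrite -scalemxAl -scalemxAr -scalerBr Z_comm scale_scalar_mx.
Qed.

(** By bilinearity the commutators form the matrix [g^T J g]; a symplectic substitution therefore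
    preserves the Weyl relations. *)
Lemma gZ_comm g k m : inSp g -> gZ g k *m gZ g m - gZ g m *m gZ g k = (J k m)%:M.
Proof.
move=> hg; rewrite [gZ g m]/gZ [X in X - _]mulmx_sumr [X in _ - X]mulmx_suml -sumrB.
under eq_bigr => b _ do rewrite -scalemxAl -scalemxAr -scalerBr gZ_Z scale_scalar_mx.
rewrite -rmorph_sum; congr (_%:M).
have /matrixP/(_ k m) := hg; rewrite mxE => <-; apply: eq_bigr => b _.
rewrite mulrC mxE; congr (_ * _); apply: eq_bigr => l _.
by rewrite [g^T k l]mxE.
Qed.

Lemma es_opD b i : es b *m opD i = (b i).+1%:R *: es (b + U_(i))%MM.
Proof.
apply: mx_ext => a ha; rewrite -mulmxA opD_e -scalemxAr -scalemxAl es_e //.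
case E: (a i) => [|m].
  rewrite scale0r; case: eqP => [ab|_]; last by rewrite raddf0 scaler0.
  by move: E; rewrite -ab mnmDE mnm1E eqxx addn1.
have aE : (a - U_(i) + U_(i))%MM = a by rewrite submK // lep1mP E.
rewrite es_e; last by apply: (@inboxDl _ U_(i)%MM); rewrite aE.
rewrite -{2}aE eqm_add2r; case: eqP => [->|_]; last by rewrite raddf0 !scaler0.
by rewrite mnmBE mnm1E eqxx E subn1.
Qed.

Lemma nat_pchar_neq0 k : (0 < k < p)%N -> k%:R != 0 :> P.
Proof.
move=> /andP[k0 kp]; rewrite -(dvdn_pcharf hchar).
by apply/negP => /(dvdn_leq k0); rewrite leqNgt kp.
Qed.

(** Differentiation multiplies the coefficient of a monomial by its exponent [a i], which is
    invertible in [P] when [0 < a i < p]. *)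
Lemma ker_opD (y : 'cV[P]_N) : (forall i, opD i *m y = 0) -> exists c, y = c *: e 0%MM.
Proof.
move=> hy; exists ((es 0%MM *m y) 0 0); apply: trmx_inj.
apply: mx_ext => a ha; rewrite linearZ /= -scalemxAl -/(es _) es_e // eq_sym.
have yE b : y^T *m e b = es b *m y.
  rewrite -[LHS]trmxK trmx_mul trmxK.
  by apply/matrixP=> i j; rewrite [LHS]mxE !ord1.
rewrite yE; case: eqP => [->|/eqP a0].
  by rewrite scale_scalar_mx mulr1 -mx11_scalar.
rewrite raddf0 scaler0.
have [i ai] : exists i, (0 < a i)%N.
  apply: NNPP => h; case/eqP: a0; apply/mnmP => j; rewrite mnm0E.
  by apply/eqP; rewrite -leqn0 leqNgt; apply/negP => aj; apply: h; exists j.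
have aE : (a - U_(i) + U_(i))%MM = a by rewrite submK // lep1mP -lt0n.
have := congr1 (fun x => es (a - U_(i))%MM *m x) (hy i).
rewrite mulmx0 mulmxA es_opD aE -scalemxAl => /eqP.
rewrite scaler_eq0 mnmBE mnm1E eqxx subn1 prednK //.
rewrite (negPf (nat_pchar_neq0 _)) ?ai ?(forallP ha) //= => /eqP //.
Qed.

Lemma ker_opX (r : 'rV[P]_N) : (forall i, r *m opX i = 0) -> exists c, r = c *: es 0%MM.
Proof.
move=> hr; exists ((r *m e 0%MM) 0 0); apply: mx_ext => a ha.
rewrite -scalemxAl es_e // eq_sym; case: eqP => [->|/eqP a0].
  by rewrite scale_scalar_mx mulr1 -mx11_scalar.
rewrite raddf0 scaler0; elim/mnm_ind: a a0 {ha} => [|a j _ _]; first by rewrite eqxx.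
by rewrite -opX_e mulmxA hr mul0mx.
Qed.

(** The image of the monomial 1 under [M] is killed by all derivations, hence is a multiple of 1;
    the multiplications carry the same factor to every monomial. *)
Lemma Z_centralizer (M : 'M[P]_N) : (forall k, M *m Z k = Z k *m M) -> exists c, M = c%:M.
Proof.
move=> hM; have [i|c hc] := @ker_opD (M *m e 0%MM).
  by rewrite -Z_lshift mulmxA -hM Z_lshift -mulmxA opD_e mnm0E scale0r mulmx0.
exists c; apply: mx_ext => a _; rewrite mul_scalar_mx.
elim/mnm_ind: a => [//|a j IH].
by rewrite -opX_e mulmxA -Z_rshift hM Z_rshift -mulmxA IH -scalemxAr.
Qed.

Lemma N_expn : N = (p ^ n)%N.
Proof. by rewrite card_ffun !card_ord. Qed.

Lemma e0_neq0 : e 0%MM != 0.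
Proof.
rewrite /e inbox0; apply/eqP => /matrixP/(_ (enum_rank (boxm 0%MM)) 0)/eqP.
by rewrite !mxE !eqxx oner_eq0.
Qed.

Lemma odd_p : odd p.
Proof.
have [/eqP p2|//] := even_prime (pcharf_prime hchar).
by move: hp2; rewrite (eqP p2).
Qed.

Lemma two_neq0 : 1 + 1 != 0 :> P.
Proof. by have := @nat_pchar_neq0 2; apply. Qed.

(* The p-th power is central, hence scalar; conjugation by [par] changes its sign. *)
Lemma gZ_nilp g k : gZ g k ^+ p = 0.
Proof.
have [b|c hc] := @Z_centralizer (gZ g k ^+ p).
  rewrite (comm_scalar_exp p (gZ_Z g k b)) -mulr_natr (pcharf0 hchar) mulr0.
  by rewrite scale0r addr0.
have parg : par *m gZ g k = - gZ g k *m par.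
  rewrite /gZ mulmx_sumr -sumrN mulmx_suml; apply: eq_bigr => l _.
  by rewrite -scalemxAr par_Z mulNmx -scalemxAl scalerN.
have parX q : par *m gZ g k ^+ q = (- gZ g k) ^+ q *m par.
  elim: q => [|q IH]; first by rewrite !expr0 mulmx1 mul1mx.
  by rewrite !exprS mulmxA parg -mulmxA IH mulmxA.
have := parX p; rewrite exprNn -signr_odd odd_p expr1 mulN1r hc.
rewrite scalar_mxC mulNmx => /eqP; rewrite -subr_eq0 opprK -mulmxDl -raddfD mul_scalar_mx.
move=> /eqP/(congr1 (fun M => M *m e 0%MM)).
rewrite mul0mx -scalemxAl par_e mdeg0 expr0 scale1r => /eqP.
rewrite scaler_eq0 (negPf e0_neq0) orbF -mulr2n -mulr_natr mulf_eq0.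
by rewrite (negPf two_neq0) orbF => /eqP ->; rewrite raddf0.
Qed.

End Weyl.

(** * The Weil representation *)

Section Weil.
Variables (P : closedFieldType) (p n : nat).
Hypotheses (hchar : p \in [pchar P]) (hp2 : (2 < p)%N).
Local Notation J := (Jform P n).
Local Notation N := #|box p n|.
Local Notation e := (@e P p n hp2).
Local Notation Z := (@Z P p n hp2).
Local Notation gZ := (@gZ P p n hp2).
Local Notation opD := (@opD P p n hp2).
Local Notation par := (@par P p n hp2).
Implicit Types g h : 'M[P]_(n + n).

Lemma mxprod_mulX (X : 'I_n -> 'M[P]_N) (a : 'X_{1..n}) i (s : seq 'I_n) :
  (forall i j, X i *m X j = X j *m X i) -> uniq s -> i \in s ->
  X i * \prod_(j <- s) X j ^+ a j = \prod_(j <- s) X j ^+ (a + U_(i))%MM j.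
Proof.
move=> XX; elim: s => //= k s IH /andP[ks us]; rewrite !big_cons mnmDE mnm1E.
case: (eqVneq i k) => [-> _|ik].
  rewrite mulrA -exprS addn1; congr (_ * _); apply: eq_big_seq => j js.
  by rewrite mnmDE mnm1E; case: eqP js ks => [->|_ _ _]; [move=> -> | rewrite addn0].
rewrite in_cons (negPf ik) => /= si; rewrite addn0 -IH // !mulrA; congr (_ * _).
by apply: commrX; apply: XX.
Qed.

Definition intertw g (S : 'M[P]_N) := forall k, S *m Z k = gZ g k *m S.

(* Both sides are irreducible modules over the same truncated Weyl algebra: a
   vector killed by the transformed derivations generates a copy of W. *)
Lemma intertw_exists g : inSp g -> exists S, S \in unitmx /\ intertw g S.
Proof.
move=> hg; pose X i := gZ g (rshift n i); pose D i := gZ g (lshift n i).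
have XX i j : X i *m X j = X j *m X i.
  by apply/eqP; rewrite -subr_eq0 gZ_comm // block_mxEdr mxE raddf0.
have DD i j : D i *m D j = D j *m D i.
  by apply/eqP; rewrite -subr_eq0 gZ_comm // block_mxEul mxE raddf0.
have DX i j : D i *m X j = X j *m D i + ((i == j)%:R)%:M.
  by apply/eqP; rewrite addrC -subr_eq gZ_comm // block_mxEur mxE.
have nilX i : X i ^+ p = 0 by apply: gZ_nilp.
have nilD i : D i ^+ p = 0 by apply: gZ_nilp.
have [//|v [v0 _ Dv]] := @common_kernel P N n p D (fun=> True) _ DD nilD _ (e0_neq0 P n hp2) I.
pose s (a : 'X_{1..n}) : 'cV[P]_N := (\prod_j X j ^+ a j) *m v.
have s0 : s 0%MM = v.
  by rewrite /s big1 ?mul1mx // => j _; rewrite mnm0E expr0.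
have sX a i : s (a + U_(i))%MM = X i *m s a.
  rewrite /s mulmxA -[_ *m \prod__ _]/(_ * _) mxprod_mulX ?mem_index_enum //.
  exact: index_enum_uniq.
(* The vectors [s a] must vanish wherever [e a] does; this uses the nilpotency of the transformed
   multiplications. *)
have sout a : ~~ inbox p a -> s a = 0.
  move=> /forallPn [j]; rewrite -leqNgt => pj.
  have -> : a = (a - U_(j) *+ p + U_(j) *+ p)%MM.
    rewrite submK //; apply/mnm_lepP => i; rewrite mulmnE mnm1E.
    by case: eqP => [<-|_]; rewrite ?mul1n ?mul0n.
  have sXk b k : s (b + U_(j) *+ k)%MM = X j ^+ k *m s b.
    elim: k => [|k IH]; first by rewrite mulm0n addm0 expr0 mul1mx.
    by rewrite mulmSr addmA sX IH mulmxA -[_ *m (_ ^+ _)]/(_ * _) -exprS.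
  by rewrite sXk nilX mul0mx.
have sD a i : D i *m s a = (a i)%:R *: s (a - U_(i))%MM.
  elim/mnm_ind: a => [|a j IH]; first by rewrite s0 Dv mnm0E scale0r.
  rewrite sX mulmxA DX mulmxDl -mulmxA IH -scalemxAr -sX mul_scalar_mx mnmDE mnm1E eq_sym.
  case: eqP => [->|ij].
    rewrite addmK addn1 -natr1 scalerDl scale1r; congr (_ + _).
    by case E: (a i) => [|m]; rewrite ?scale0r // submK // lep1mP E.
  rewrite addn0 scale0r addr0; case E: (a i) => [|m]; rewrite ?scale0r //.
  congr (_ *: s _); rewrite addmC -[RHS](_ : (U_(j) + a - U_(i))%MM = _); last first.
    by rewrite [(U_(j) + a)%MM]addmC.
  by rewrite addmBA // lep1mP E.
pose S := op p s.
have Se a : S *m e a = s a.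
  have [ha|ha] := boolP (inbox p a); first by rewrite op_e.
  by rewrite e_out // mulmx0 sout.
have SZ k : S *m Z k = gZ g k *m S.
  apply: mx_ext => a _; rewrite -!mulmxA Se.
  case: (split_ordP k) => i ->; rewrite ?Z_lshift ?Z_rshift.
    by rewrite opD_e // -scalemxAr Se -/(D i) sD.
  by rewrite opX_e Se -/(X i) sX.
(* The kernel of [S] is stable under the derivations. If nonzero, it would contain a vector killed
   by all of them, a multiple of 1, whereas [S] sends 1 to [v]. *)
exists S; split=> //; apply: inj_unitmx => y Sy; apply: NNPP => /eqP y0.
have Dk i : opD i ^+ p = 0 by rewrite -Z_lshift -gZ1 gZ_nilp.
have [|z [z0 Sz Dz]] := common_kernel (opDD hchar hp2) Dk (Q := fun y => S *m y = 0) _ y0 Sy.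
  by move=> i w Sw; rewrite mulmxA -Z_lshift SZ -mulmxA Sw mulmx0.
have [c zc] := ker_opD hchar Dz.
move: Sz z0; rewrite zc -scalemxAr Se s0 => /eqP; rewrite !scaler_eq0 (negPf v0) orbF.
by move=> ->.
Qed.

Lemma intertwM g h S T : intertw g S -> intertw h T -> intertw (g *m h) (S *m T).
Proof.
move=> hS hT k; rewrite -mulmxA hT /gZ !mulmxA mulmx_sumr !mulmx_suml.
under eq_bigr => l _ do rewrite -scalemxAr hS /gZ mulmx_suml scaler_sumr mulmx_suml.
rewrite exchange_big /=; apply: eq_bigr => m _.
rewrite [(g *m h) m k]mxE scaler_suml !mulmx_suml; apply: eq_bigr => l _.
by rewrite -!scalemxAl scalerA mulrC.
Qed.

Lemma intertw_scale g c S : intertw g S -> intertw g (c *: S).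
Proof. by move=> hS k; rewrite -scalemxAl hS scalemxAr. Qed.

Lemma intertw_uniq g S T : S \in unitmx -> intertw g S -> intertw g T ->
  exists c, T = c *: S.
Proof.
move=> Su hS hT; have [k|c hc] := Z_centralizer hchar (hp2 := hp2) (M := invmx S *m T).
  apply: (can_inj (mulKmx Su)); rewrite !mulmxA mulmxV // mul1mx hT hS.
  by rewrite -!mulmxA mulKVmx.
by exists c; rewrite -[T](mulKVmx Su) hc mul_mx_scalar.
Qed.

(** Boolean, so that [xchoose] can select the operator. *)
Definition isWeil g S := (\det S == 1) && [forall k, S *m Z k == gZ g k *m S].

Lemma isWeilP g S : reflect (\det S = 1 /\ intertw g S) (isWeil g S).
Proof.
apply: (iffP andP) => [[/eqP dS /forallP hS]|[dS hS]]; split=> //; rewrite ?dS //.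
  by move=> k; apply/eqP.
by apply/forallP => k; apply/eqP.
Qed.

Lemma N_gt0 : (0 < N)%N.
Proof. by rewrite N_expn expn_gt0 (ltnW (ltnW hp2)). Qed.

Lemma isWeil_exists g : inSp g -> exists S, isWeil g S.
Proof.
move=> /intertw_exists [S [Su hS]].
have dS : \det S != 0 by rewrite -unitfE -unitmxE.
(* Scaling by [c] multiplies the determinant by [c ^+ N], so an [N]-th root is taken in the closed
   field. *)
have [c hc] : exists c, c ^+ N = (\det S)^-1.
  move: (\det S)^-1 => d.
  have [c cE] := @solve_monicpoly P N (fun i => if i == 0%N then d else 0) N_gt0.
  exists c; rewrite {}cE; move: N_gt0; case: N => // m _.
  by rewrite big_ord_recl /= expr0 mulr1 big1 ?addr0 // => i _; rewrite mul0r.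
exists (c *: S); apply/isWeilP; split; last exact: intertw_scale.
by rewrite detZ hc mulVf.
Qed.

(* The Weil representation; the value off [Sp] is irrelevant. *)
Definition Weil g : 'M[P]_N :=
  if @eqP _ (g^T *m J *m g) J is ReflectT h then xchoose (isWeil_exists h) else 1%:M.

Lemma Weil_isWeil g : inSp g -> \det (Weil g) = 1 /\ intertw g (Weil g).
Proof.
by move=> hg; apply/isWeilP; rewrite /Weil; case: eqP => // h; apply: xchooseP.
Qed.

Lemma Weil_det g : inSp g -> \det (Weil g) = 1.
Proof. by move/Weil_isWeil => []. Qed.

Lemma Weil_Z g k : inSp g -> Weil g *m Z k = gZ g k *m Weil g.
Proof. by move/Weil_isWeil => []. Qed.

Lemma Weil_unit g : inSp g -> Weil g \in unitmx.
Proof. by move/Weil_det => hd; rewrite unitmxE hd unitr1. Qed.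

Lemma Weil_uniqZ g S : inSp g -> intertw g S -> exists c, S = c *: Weil g.
Proof.
by move=> hg hS; apply: intertw_uniq hS; [apply: Weil_unit | move=> k; apply: Weil_Z].
Qed.

Lemma Weil_uniq g S : inSp g -> \det S = 1 -> intertw g S -> Weil g = S.
Proof.
move=> hg dS hS; have [c cE] := Weil_uniqZ hg hS.
have c1 : c = 1.
  move: dS; rewrite cE detZ Weil_det // mulr1 => cN.
  by apply: (exp_pcharX_eq1 hchar (j := n)); rewrite -N_expn.
by rewrite cE c1 scale1r.
Qed.

Lemma Weil1 : Weil 1%:M = 1%:M.
Proof.
apply: Weil_uniq; rewrite ?det1 //; first exact: inSp1.
by move=> k; rewrite mul1mx mulmx1 gZ1.
Qed.

Lemma WeilM g h : inSp g -> inSp h -> Weil (g *m h) = Weil g *m Weil h.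
Proof.
move=> hg hh; apply: Weil_uniq; first exact: inSpM.
  by rewrite det_mulmx !Weil_det // mulr1.
by apply: intertwM => k; apply: Weil_Z.
Qed.

Lemma par2 : par *m par = 1%:M.
Proof.
apply: mx_ext => a _; rewrite -mulmxA par_e -scalemxAr par_e scalerA mul1mx.
by rewrite -exprMn mulrNN mulr1 expr1n scale1r.
Qed.

Lemma par_gZ g k : par *m gZ g k = - (gZ g k *m par).
Proof.
rewrite /gZ mulmx_sumr mulmx_suml -sumrN; apply: eq_bigr => l _.
by rewrite -scalemxAr par_Z // scalerN scalemxAl.
Qed.

(** Conjugation by [par] changes the sign of every [Z k] and of every [gZ g k], so the conjugate of
    [Weil g] meets the conditions that characterize [Weil g]. *)
Lemma Weil_par g : inSp g -> Weil g *m par = par *m Weil g.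
Proof.
move=> hg; suff E : Weil g = par *m Weil g *m par.
  by rewrite {1}E -!mulmxA par2 mulmx1.
apply: Weil_uniq => //.
  by rewrite !det_mulmx Weil_det // mulr1 -det_mulmx par2 det1.
move=> k; rewrite -!mulmxA par_Z // !mulmxN !(mulmxA (Weil g)) Weil_Z // -!mulmxA.
by rewrite (mulmxA par (gZ _ _)) par_gZ mulNmx opprK -mulmxA.
Qed.

End Weil.

(** * Unipotent elements have p-power order *)

Section Unipotents.
Variables (P : closedFieldType) (p n : nat).
Hypotheses (hchar : p \in [pchar P]).

Lemma gr_bound (a b : 'I_(n + n)) : gr a - gr b < (2 * n).+1%:Z.
Proof.
by case: (split_ordP a) => i ->; case: (split_ordP b) => j ->;
  rewrite ?gr_lshift ?gr_rshift; lia.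
Qed.

(** [u - 1] raises the degree [gr], whose values differ by at most [2n], so its power with exponent
    [p ^ (2 * n).+1] is zero. *)
Lemma uptri_exp_eq1 (u : 'M[P]_(n + n)) : uptri u -> u ^+ (p ^ (2 * n).+1) = 1.
Proof.
move=> hu; pose M : 'M[P]_(n + n) := u - 1.
have M0 a b : gr a <= gr b -> M a b = 0.
  by move=> ab; rewrite !mxE hu // subrr.
have Mk k : forall a b, gr a < gr b + k%:Z -> (M ^+ k) a b = 0.
  elim: k => [|k IH] a b ab.
    by rewrite expr0 mxE; case: eqP ab => // ->; rewrite addr0 ltxx.
  rewrite exprS mxE big1 // => c _; have [ac|ca] := leP (gr a) (gr c).
    by rewrite M0 // mul0r.
  by rewrite IH ?mulr0 //; move: ab ca; lia.
have -> : u = 1 + M by rewrite addrC subrK.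
rewrite (mx_1D_exp_pcharX hchar) -[RHS]addr0; congr (_ + _).
apply/matrixP => a b; rewrite mxE; apply: Mk.
have := gr_bound a b; have := ltn_expl (2 * n).+1 (prime_gt1 (pcharf_prime hchar)).
by move: (p ^ _)%N => q; lia.
Qed.

Lemma inSpX (g : 'M[P]_(n + n)) k : inSp g -> inSp (g ^+ k).
Proof.
move=> hg; elim: k => [|k IH]; first exact: inSp1.
by rewrite exprS; apply: inSpM.
Qed.

End Unipotents.

(** * Torus and unipotent elements in the Weil representation *)

Section WeilElements.
Variables (P : closedFieldType) (p n : nat).
Hypotheses (hchar : p \in [pchar P]) (hp2 : (2 < p)%N).
Local Notation N := #|box p n|.
Local Notation e := (@e P p n hp2).
Local Notation es := (@es P p n hp2).
Local Notation Z := (@Z P p n hp2).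
Local Notation gZ := (@gZ P p n hp2).
Local Notation opX := (@opX P p n hp2).
Local Notation opD := (@opD P p n hp2).
Local Notation Weil := (@Weil P p n hchar hp2).
Implicit Types g h u l : 'M[P]_(n + n).

Definition wt (a : 'X_{1..n}) : 'I_n -> int := fun i => ((p - 1)./2)%:Z - (a i)%:Z.

Lemma prod_expz_sum (I : finType) (x : P) (F : I -> int) : x != 0 ->
  \prod_i x ^ (F i) = x ^ (\sum_i F i).
Proof.
move=> x0; rewrite (big_morph (fun m : int => x ^ m) (id1 := 1) (op1 := *%R)) ?expr0z //.
by move=> a b; apply: expfzDr.
Qed.

(** The involution a -> p-1-a of the box changes the sign of the weight; this is why the weights are
    centred at (p-1)/2. *)
Lemma sum_wt (i : 'I_n) : \sum_(x : box p n) wt (mnmb x) i = 0.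
Proof.
pose f (x : box p n) : box p n := [ffun j => rev_ord (x j)].
have fK : involutive f by move=> x; apply/ffunP => j; rewrite !ffunE rev_ordK.
have E : \sum_(x : box p n) wt (mnmb x) i = - \sum_(x : box p n) wt (mnmb x) i.
  rewrite {1}(reindex_inj (inv_inj fK)) -sumrN; apply: eq_bigr => x _.
  rewrite /wt !mnmE ffunE /=; move: (ltn_ord (x i)); move: (nat_of_ord _) => m mp.
  have pE : ((p - 1)./2 + (p - 1)./2 + 1 = p)%N.
    have p0 : (0 < p)%N by apply: leq_ltn_trans mp.
    by rewrite addnn even_halfK ?subnK // oddB // (odd_p hchar hp2).
  by move: pE mp; move: (_./2) => q; lia.
by move: E; lia.
Qed.

Definition torusW (t : 'I_n -> P) : 'M[P]_N :=
  diag_mx (\row_k char_val (wt (mnmb (enum_val k))) t).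

Lemma torusW_e t a : torusW t *m e a = char_val (wt a) t *: e a.
Proof.
have [ha|ha] := boolP (inbox p a); last by rewrite e_out // mulmx0 scaler0.
rewrite /e ha; apply/colP => k; rewrite mul_diag_mx !mxE.
case: eqP => [->|]; last by rewrite !mulr0.
by rewrite enum_rankK boxmK.
Qed.

Lemma det_torusW t : (forall i, t i != 0) -> \det (torusW t) = 1.
Proof.
move=> ht; rewrite det_diag; under eq_bigr => k _ do rewrite mxE.
rewrite exchange_big big1 //= => i _; rewrite prod_expz_sum //.
have -> : \sum_(k : 'I_N) wt (mnmb (enum_val k)) i = \sum_(x : box p n) wt (mnmb x) i.
  rewrite [RHS](reindex (fun k : 'I_N => enum_val k)) //=.
  by exists enum_rank => x _; rewrite ?enum_valK ?enum_rankK.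
by rewrite sum_wt expr0z.
Qed.

Lemma char_valD (chi psi : 'I_n -> int) (t : 'I_n -> P) : (forall i, t i != 0) ->
  char_val (fun i => chi i + psi i) t = char_val chi t * char_val psi t.
Proof.
by move=> ht; rewrite -big_split; apply: eq_bigr => i _; rewrite expfzDr.
Qed.

Lemma char_val1 (j : 'I_n) (z : int) (t : 'I_n -> P) :
  char_val (fun i => (i == j)%:R * z) t = t j ^ z.
Proof.
rewrite /char_val (bigD1 j) //= eqxx mul1r big1 ?mulr1 // => i ij.
by rewrite (negPf ij) mul0r expr0z.
Qed.

Lemma wtD a j (t : 'I_n -> P) : (forall i, t i != 0) ->
  char_val (wt (a + U_(j))%MM) t = char_val (wt a) t * (t j)^-1.
Proof.
move=> ht; rewrite -(exprN1 (t j)) -char_val1 -char_valD //.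
apply: eq_bigr => i _; congr (_ ^ _); rewrite /wt mnmDE mnm1E eq_sym.
by case: eqP; lia.
Qed.

Lemma gZ_torus_l (t : 'I_n -> P) i : gZ (torus_elt t) (lshift n i) = t i *: opD i.
Proof.
rewrite /gZ (bigD1 (lshift n i)) //= big1 => [|a].
  by rewrite addr0 block_mxEul !mxE eqxx Z_lshift.
case: (split_ordP a) => j ->; last by rewrite block_mxEdl mxE scale0r.
by rewrite eq_lshift block_mxEul !mxE => /negPf ->; rewrite scale0r.
Qed.

Lemma gZ_torus_r (t : 'I_n -> P) i : gZ (torus_elt t) (rshift n i) = (t i)^-1 *: opX i.
Proof.
rewrite /gZ (bigD1 (rshift n i)) //= big1 => [|a].
  by rewrite addr0 block_mxEdr !mxE eqxx Z_rshift.
case: (split_ordP a) => j ->; first by rewrite block_mxEur mxE scale0r.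
by rewrite eq_rshift block_mxEdr !mxE => /negPf ->; rewrite scale0r.
Qed.

(** [torusW t] meets both conditions that determine [Weil]: its determinant is 1, and multiplication
    by x_i divides the character by [t i], as the substitution requires. *)
Lemma Weil_torus (t : 'I_n -> P) : (forall i, t i != 0) -> Weil (torus_elt t) = torusW t.
Proof.
move=> ht; apply: Weil_uniq; [exact: inSp_torus | exact: det_torusW | move=> k].
apply: mx_ext => a _; rewrite -!mulmxA torusW_e -scalemxAr.
case: (split_ordP k) => i ->.
  rewrite gZ_torus_l Z_lshift -scalemxAl opD_e // -scalemxAr torusW_e !scalerA.
  case E: (a i) => [|m]; first by rewrite !(mul0r, mulr0).
  have -> : char_val (wt a) t = char_val (wt (a - U_(i))%MM) t * (t i)^-1.
    by rewrite -wtD // submK // lep1mP E.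
  by rewrite mulfVK // mulrC.
by rewrite gZ_torus_r Z_rshift -scalemxAl opX_e torusW_e wtD // scalerA.
Qed.

Lemma Weil_torus_e (t : 'I_n -> P) a : (forall i, t i != 0) ->
  Weil (torus_elt t) *m e a = char_val (wt a) t *: e a.
Proof. by move=> ht; rewrite Weil_torus // torusW_e. Qed.

Lemma Weil_torus_es (t : 'I_n -> P) a : (forall i, t i != 0) ->
  es a *m Weil (torus_elt t) = char_val (wt a) t *: es a.
Proof.
move=> ht; apply: trmx_inj; rewrite trmx_mul linearZ /= /es trmxK.
by rewrite Weil_torus // tr_diag_mx torusW_e.
Qed.

Lemma WeilX g k : inSp g -> Weil (g ^+ k) = Weil g ^+ k.
Proof.
move=> hg; elim: k => [|k IH]; first by rewrite !expr0 Weil1.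
by rewrite !exprS WeilM ?IH //; apply: inSpX.
Qed.

(** The substitution given by [u] sends derivations to combinations of derivations, so their common
    kernel, the line of 1, is stable. Since [u] has p-power order, so has the eigenvalue, which is
    then 1. *)
Lemma Weil_up_e0 u : inSp u -> uptri u -> Weil u *m e 0%MM = e 0%MM.
Proof.
move=> hu tu; have Wu := Weil_unit hchar hp2 hu.
have [i|c hc] := @ker_opD P p n hchar hp2 (invmx (Weil u) *m e 0%MM).
  have -> : opD i *m (invmx (Weil u) *m e 0%MM) =
      invmx (Weil u) *m (gZ u (lshift n i) *m e 0%MM).
    apply: (can_inj (mulKmx Wu)); rewrite [in RHS]mulmxA mulmxV // mul1mx.
    by rewrite mulmxA -Z_lshift Weil_Z // -mulmxA mulKVmx.
  rewrite /gZ mulmx_suml big1 ?mulmx0 // => a _; rewrite -scalemxAl.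
  case: (split_ordP a) => j ->.
    by rewrite Z_lshift opD_e // mnm0E scale0r scaler0.
  rewrite tu ?eq_rlshift ?scale0r //.
  by rewrite ltW // (lt_trans (gr_rshift_lt0 _) (gr_lshift_gt0 _)).
have e1 : e 0%MM = c *: (Weil u *m e 0%MM) by rewrite scalemxAr -hc mulKVmx.
have eX k : e 0%MM = c ^+ k *: (Weil u ^+ k *m e 0%MM).
  elim: k => [|k IH]; first by rewrite !expr0 mul1mx scale1r.
  rewrite {1}IH {1}e1 !exprSr -scalemxAr scalerA -[_ ^+ k * Weil u]/(_ *m _).
  by rewrite mulmxA.
have /eqP := eX (p ^ (2 * n).+1)%N; rewrite -WeilX // (uptri_exp_eq1 hchar) // Weil1 mul1mx.
rewrite -{1}[e 0%MM]scale1r -subr_eq0 -scalerBl scaler_eq0 (negPf (e0_neq0 P n hp2)) orbF.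
rewrite subr_eq0 eq_sym => /eqP/(exp_pcharX_eq1 hchar) c1.
by rewrite {2}e1 c1 scale1r.
Qed.

Lemma es0_opX i : es 0%MM *m opX i = 0.
Proof.
apply: mx_ext => a _; rewrite -mulmxA opX_e mul0mx.
have [ha|ha] := boolP (inbox p (a + U_(i))%MM); last by rewrite e_out // mulmx0.
rewrite es_e //; case: eqP => [/mnmP/(_ i)|_]; last by rewrite raddf0.
by rewrite mnmDE mnm0E mnm1E eqxx addn1.
Qed.

Lemma es0_neq0 : es 0%MM != 0.
Proof.
by apply: contraNneq (e0_neq0 P n hp2) => h; apply/eqP/trmx_inj; rewrite -/(es _) h trmx0.
Qed.

(** The dual argument: [l] sends multiplications to combinations of multiplications, and these
    annihilate only the line of the row vector [es 0]. *)
Lemma Weil_dn_es0 l : inSp l -> dntri l -> es 0%MM *m Weil l = es 0%MM.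
Proof.
move=> hl tl.
have [i|c hc] := @ker_opX P p n hp2 (es 0%MM *m Weil l).
  rewrite -mulmxA -Z_rshift Weil_Z // mulmxA /gZ mulmx_sumr big1 ?mul0mx // => a _.
  rewrite -scalemxAr; case: (split_ordP a) => j ->; last by rewrite Z_rshift es0_opX scaler0.
  have := tl (rshift n i) (lshift n j); rewrite mxE => ->; rewrite ?eq_rlshift ?scale0r //.
  by rewrite ltW // (lt_trans (gr_rshift_lt0 _) (gr_lshift_gt0 _)).
have eX k : es 0%MM *m Weil l ^+ k = c ^+ k *: es 0%MM.
  elim: k => [|k IH]; first by rewrite !expr0 mulmx1 scale1r.
  by rewrite exprSr -[_ ^+ k * Weil l]/(_ *m _) mulmxA IH -scalemxAl hc scalerA -exprSr.
have lX : l ^+ (p ^ (2 * n).+1) = 1.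
  apply: trmx_inj; rewrite -[1]/(1%:M) trmx1 -[RHS](uptri_exp_eq1 hchar tl).
  elim: (p ^ _)%N => [|k IH]; first by rewrite !expr0 trmx1.
  by rewrite exprSr -[_ * l]/(_ *m l) trmx_mul IH exprS.
have /eqP := eX (p ^ (2 * n).+1)%N; rewrite -WeilX // lX Weil1 mulmx1.
rewrite -{1}[es 0%MM]scale1r -subr_eq0 -scalerBl scaler_eq0 (negPf es0_neq0) orbF.
rewrite subr_eq0 eq_sym => /eqP/(exp_pcharX_eq1 hchar) c1.
by rewrite hc c1 scale1r.
Qed.

Lemma es0_opD i : es 0%MM *m opD i = es U_(i)%MM.
Proof. by rewrite es_opD // mnm0E add0m scale1r. Qed.

Section Last.
Variables (i0 : 'I_n) (hi0 : i0.+1 = n).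

(** Because [i0] is the last index, [u] fixes multiplication by x_i0 up to derivations, which kill
    1. *)
Lemma Weil_up_e1 u : inSp u -> uptri u -> Weil u *m e U_(i0)%MM = e U_(i0)%MM.
Proof.
move=> hu tu; rewrite -[U_(i0)%MM]add0m -opX_e mulmxA -Z_rshift Weil_Z //.
rewrite -mulmxA Weil_up_e0 // /gZ mulmx_suml (bigD1 (rshift n i0)) //= tu // eqxx scale1r.
rewrite big1 ?addr0 // => a; rewrite -scalemxAl; case: (split_ordP a) => j ->.
  by rewrite Z_lshift opD_e // mnm0E scale0r scaler0.
move=> ja; rewrite tu ?(negPf ja) ?scale0r // gr_rrE -ltnS hi0.
exact: ltn_ord.
Qed.

(** [es U_(i0)] is [es 0] followed by d/dx_i0, which [l] fixes up to multiplications, and these are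
    killed by [es 0]. *)
Lemma Weil_dn_es1 l : inSp l -> dntri l -> es U_(i0)%MM *m Weil l = es U_(i0)%MM.
Proof.
move=> hl tl; rewrite -es0_opD -{2}(Weil_dn_es0 hl tl) -[RHS]mulmxA -Z_lshift Weil_Z //.
rewrite mulmxA; congr (_ *m _); rewrite /gZ mulmx_sumr (bigD1 (lshift n i0)) //= big1.
  by have := tl (lshift n i0) (lshift n i0); rewrite mxE eqxx => ->; rewrite ?scale1r ?addr0.
move=> a; rewrite -scalemxAr; case: (split_ordP a) => j ->.
  move=> ja; have := tl (lshift n i0) (lshift n j); rewrite mxE => ->.
    by rewrite eq_sym (negPf ja) scale0r.
  by rewrite gr_llE -ltnS hi0 ltn_ord.
by rewrite Z_rshift es0_opX scaler0.
Qed.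

End Last.
End WeilElements.

(* Every monomial of the parity of [a0] (which is 1 or x_i0) is reached from it
   by adding pairs of variables, after exchanging x_i0 for another variable. *)
Lemma mnm_step_ind n p (Q : 'X_{1..n} -> Prop) (a0 : 'X_{1..n}) (i0 : 'I_n) :
  a0 = 0%MM \/ a0 = U_(i0)%MM -> Q a0 ->
  (forall a i j, Q a -> inbox p (a + U_(i) + U_(j))%MM -> Q (a + U_(i) + U_(j))%MM) ->
  (forall j, Q U_(i0)%MM -> Q U_(j)%MM) ->
  forall a, inbox p a -> odd (mdeg a) = odd (mdeg a0) -> Q a.
Proof.
move=> ha0 Q0 Q2 Q1.
have pos (a : 'X_{1..n}) : a != 0%MM -> exists i, a = (a - U_(i) + U_(i))%MM.
  move=> an0; have [i ai] : exists i, (0 < a i)%N.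
    apply: NNPP => h; case/eqP: an0; apply/mnmP => j; rewrite mnm0E.
    by apply/eqP; rewrite -leqn0 leqNgt; apply/negP => aj; apply: h; exists j.
  by exists i; rewrite submK // lep1mP -lt0n.
move=> a; have [d] := ubnP (mdeg a); elim: d a => // d IH a ad ain oda.
case: (eqVneq a 0%MM) => [a_0|/pos [i aE]].
  by case: ha0 => E; move: oda Q0; rewrite E a_0 // mdeg0 mdeg1.
set b := (a - U_(i))%MM in aE *.
case: (eqVneq b 0%MM) => [b0|/pos [j bE]].
  move: aE; rewrite b0 add0m => aE; rewrite aE; apply: Q1.
  by case: ha0 => E; move: oda Q0; rewrite E aE // mdeg0 mdeg1.
set c := (b - U_(j))%MM in bE *.
have {}aE : a = (c + U_(j) + U_(i))%MM by rewrite aE {1}bE.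
rewrite aE; apply: Q2; last by rewrite -aE.
move: ad oda ain; rewrite aE !mdegD !mdeg1 !addn1 /= negbK => ad oda ain.
apply: IH => //; first by rewrite ltnW.
by apply: inboxDl; apply: inboxDl ain.
Qed.

(** The identity exp' = exp for a truncated series: the two sums differ by the top term, which the
    hypothesis on [y * Y ^+ q.-1] removes. *)
Lemma texp_shift (F : fieldType) q N (y Y : 'M[F]_N) (c : F) :
  (forall k, (0 < k < q)%N -> k%:R != 0 :> F) -> (0 < q)%N -> y * Y ^+ q.-1 = 0 ->
  \sum_(j < q) (c ^+ j / (j`!)%:R) *: (y * Y ^+ j.-1 *+ j) =
  \sum_(j < q) c *: (y * ((c ^+ j / (j`!)%:R) *: Y ^+ j)).
Proof.
case: q => // q inv _ yq.
have sAr d (A B : 'M[F]_N) : A * (d *: B) = d *: (A * B) by rewrite -!mulmxE scalemxAr.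
rewrite big_ord_recl big_ord_recr /= mulr0n scaler0 add0r.
rewrite sAr yq !scaler0 addr0; apply: eq_bigr => j _.
rewrite sAr scalerA -(scaler_nat (bump 0 j) (y * _)) scalerA add0n; congr (_ *: _).
have j0 : (j.+1)%:R != 0 :> F by apply: inv; rewrite /= ltnS ltn_ord.
rewrite /bump leq0n add1n factS natrM invfM exprS -!mulrA; congr (_ * (_ * _)).
by rewrite mulrCA mulVf ?mulr1.
Qed.

(** * Root elements and the cyclicity of the parity parts *)

Section RootElements.
Variables (P : closedFieldType) (p n : nat).
Hypotheses (hchar : p \in [pchar P]) (hp2 : (2 < p)%N).
Local Notation J := (Jform P n).
Local Notation N := #|box p n|.
Local Notation e := (@e P p n hp2).
Local Notation es := (@es P p n hp2).
Local Notation Z := (@Z P p n hp2).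
Local Notation gZ := (@gZ P p n hp2).
Local Notation opX := (@opX P p n hp2).
Local Notation opD := (@opD P p n hp2).
Local Notation Weil := (@Weil P p n hchar hp2).
Implicit Types (g h u l : 'M[P]_(n + n)) (a b : 'I_(n + n)).

(** The element of the symplectic Lie algebra that corresponds to the quadratic operator
    [Z a *m Z b]; when [J a b = 0], [rootx] is its one-parameter group. *)
Definition rootN a b : 'M[P]_(n + n) := (delta_mx a b + delta_mx b a) *m J.
Definition rootx a b (c : P) := 1%:M + c *: rootN a b.

Lemma delta_J_delta a b a' b' :
  delta_mx a b *m J *m delta_mx a' b' = J b a' *: delta_mx a b' :> 'M[P]_(n + n).
Proof.
apply/matrixP => i j; rewrite -mulmxA mxE (bigD1 b) //= big1 => [|k kb].
  rewrite !mxE eqxx andbT (bigD1 a') //= big1 => [|k ka].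
    by rewrite !addr0 !mxE eqxx /=; case: (i == a); case: (j == b'); rewrite ?(mulr1, mulr0, mul1r, mul0r).
  by rewrite [delta_mx _ _ _ _]mxE (negPf ka) mulr0.
by rewrite mxE (negPf kb) andbF mul0r.
Qed.

Lemma Jform_diag a : J a a = 0.
Proof.
by case: (split_ordP a) => i ->; rewrite ?block_mxEul ?block_mxEdr mxE.
Qed.

Lemma Jform_tr : J^T = - J.
Proof. by apply/matrixP => a b; rewrite mxE Jform_skew [RHS]mxE. Qed.

Lemma inSp_rootx a b c : J a b = 0 -> inSp (rootx a b c).
Proof.
move=> Jab; have Jba : J b a = 0 by rewrite Jform_skew Jab oppr0.
pose M : 'M[P]_(n + n) := delta_mx a b + delta_mx b a.
have MJM : M *m J *m M = 0.
  rewrite /M !mulmxDl !mulmxDr !delta_J_delta Jab Jba !Jform_diag !scale0r.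
  by rewrite !addr0.
have MT : M^T = M by rewrite /M linearD /= !trmx_delta addrC.
have RT : (1%:M + c *: (M *m J))^T = 1%:M + c *: (- J *m M).
  by rewrite linearD /= trmx1 linearZ /= trmx_mul MT Jform_tr.
rewrite /inSp /rootx /rootN -/M RT; clearbody M.
rewrite !mulmxDl !mulmxDr !mul1mx !mulmx1 -!scalemxAl -!scalemxAr.
have -> : - J *m M *m J *m (M *m J) = 0.
  by rewrite !mulmxA -2!(mulmxA (- J)) MJM mulmx0 mul0mx.
by rewrite !scaler0 addr0 !mulNmx scalerN !mulmxA addrK.
Qed.

(** The commutator of [Z a *m Z b] with [Z k]. *)
Definition yk a b k := J b k *: Z a + J a k *: Z b.

Lemma gZ_rootx a b c k : gZ (rootx a b c) k = Z k + c *: yk a b k.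
Proof.
rewrite /gZ /rootx.
under eq_bigr => l _ do rewrite mxE [(c *: rootN a b) l k]mxE scalerDl -scalerA.
rewrite big_split /= -scaler_sumr; congr (_ + _ *: _); first exact: gZ1.
have dJ a' b' (l : 'I_(n + n)) : (delta_mx a' b' *m J) l k = (l == a')%:R * J b' k.
  rewrite mxE (bigD1 b') //= big1 => [|m mb]; first by rewrite mxE eqxx andbT addr0.
  by rewrite mxE (negPf mb) andbF mul0r.
under eq_bigr => l _ do rewrite /rootN mulmxDl mxE !dJ scalerDl.
rewrite big_split /=; congr (_ + _).
  rewrite (bigD1 a) //= big1 => [|l la]; first by rewrite eqxx mul1r addr0.
  by rewrite (negPf la) mul0r scale0r.
rewrite (bigD1 b) //= big1 => [|l la]; first by rewrite eqxx mul1r addr0.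
by rewrite (negPf la) mul0r scale0r.
Qed.

Section TruncatedExp.
Variables (a b : 'I_(n + n)).
Hypothesis Jab : J a b = 0.
Let Y : 'M[P]_N := Z a *m Z b.

(* It intertwines only because [[Z a * Z b, Z k]] kills the last power of [Y]. *)
Definition texp (c : P) : 'M[P]_N := \sum_(j < p) (c ^+ j / (j`!)%:R) *: Y ^+ j.

Let sAl (c : P) (A B : 'M[P]_N) : c *: (A * B) = (c *: A) * B := scalemxAl c A B.
Let sAr (c : P) (A B : 'M[P]_N) : c *: (A * B) = A * (c *: B) := scalemxAr c A B.

Lemma ZZ_comm : GRing.comm (Z a) (Z b).
Proof. by apply/eqP; rewrite -subr_eq0 -!mulmxE Z_comm // Jab raddf0. Qed.

Lemma Y_comm : GRing.comm Y (Z a) /\ GRing.comm Y (Z b).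
Proof.
split; apply: commr_sym; apply: commrM; rewrite /GRing.comm ?ZZ_comm //.
Qed.

Lemma YZ j k : Y ^+ j * Z k = Z k * Y ^+ j + (yk a b k * Y ^+ j.-1) *+ j.
Proof.
have Y1 : Y * Z k = Z k * Y + yk a b k.
  rewrite /Y -!mulmxE -mulmxA.
  have -> : Z b *m Z k = Z k *m Z b + (J b k)%:M by rewrite -Z_comm // addrC subrK.
  rewrite mulmxDr mulmxA.
  have -> : Z a *m Z k = Z k *m Z a + (J a k)%:M by rewrite -Z_comm // addrC subrK.
  by rewrite mulmxDl mul_mx_scalar mul_scalar_mx -mulmxA -addrA [_ *: Z b + _]addrC.
have Yy : GRing.comm Y (yk a b k).
  by have [h1 h2] := Y_comm; apply: commrD; rewrite /GRing.comm -sAr -sAl; congr (_ *: _).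
elim: j => [|j IH]; first by rewrite !expr0 mul1r mulr1 mulr0n addr0.
rewrite exprS -mulrA IH mulrDr mulrA Y1 mulrDl -mulrA -exprS -addrA; congr (_ + _).
case: j {IH} => [|j]; first by rewrite mulr0n mulr0 addr0 mulr1n.
by rewrite mulrnAr mulrA Yy -mulrA -exprS /= -mulrS.
Qed.

(** [yk] is a combination of [Z a] and [Z b], and each completes a p-th power in
    [Z a ^+ p.-1 * Z b ^+ p.-1]. *)
Lemma ykY k : yk a b k * Y ^+ p.-1 = 0.
Proof.
have YE j : Y ^+ j = Z a ^+ j * Z b ^+ j by rewrite exprMn_comm //; exact: ZZ_comm.
have p1 : p = p.-1.+1 by rewrite prednK // (ltnW (ltnW hp2)).
have nil m : Z m ^+ p = 0 by rewrite -gZ1 gZ_nilp.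
rewrite /yk mulrDl -!sAl YE.
have -> : Z a * (Z a ^+ p.-1 * Z b ^+ p.-1) = 0.
  by rewrite mulrA -exprS -p1 nil mul0r.
rewrite (commrX _ (commr_sym (commrX p.-1 (commr_sym ZZ_comm)))).
by rewrite mulrA -exprS -p1 nil mul0r !scaler0 addr0.
Qed.

Lemma texp_intertw c : intertw hp2 (rootx a b c) (texp c).
Proof.
move=> k; rewrite gZ_rootx !mulmxE mulrDl -sAl /texp mulr_suml.
have p1 : p = p.-1.+1 by rewrite prednK // (ltnW (ltnW hp2)).
under eq_bigr => j _ do rewrite -sAl YZ scalerDr sAr.
rewrite big_split /= -mulr_sumr; congr (_ + _).
rewrite mulr_sumr scaler_sumr; apply: texp_shift; last exact: ykY.
  exact: nat_pchar_neq0.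
exact: ltnW (ltnW hp2).
Qed.

(** The hypothesis is a polynomial identity in [c], and the conclusion is its linear coefficient,
    present because [1 < p]. *)
Lemma texp_coef (x : 'rV[P]_N) (y : 'cV[P]_N) :
  (forall c, x *m texp c *m y = 0) -> x *m Y *m y = 0.
Proof.
move=> h; pose q : {poly P} := \poly_(j < p) ((j`!)%:R^-1 * (x *m Y ^+ j *m y) 0 0).
have q0 : q = 0.
  apply: poly_vanish => c; have /matrixP/(_ 0 0) := h c.
  rewrite [RHS]mxE => E; rewrite -[RHS]E horner_poly /texp mulmx_sumr mulmx_suml summxE.
  apply: eq_bigr => j _; rewrite -scalemxAr -scalemxAl [RHS]mxE.
  by rewrite mulrC mulrA.
have := congr1 (fun q : {poly P} => q`_1) q0.
rewrite coef_poly coef0 (ltnW hp2).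
rewrite invr1 mul1r expr1 => E.
by rewrite [LHS]mx11_scalar E raddf0.
Qed.

End TruncatedExp.

(** A substitute for passing to the Lie algebra: [texp c] is a multiple of the action of a root
    element, so the vectors killed by all [x *m Weil g] are stable under [Z a *m Z b]. *)
Lemma Weil_ZZ_l (x : 'rV[P]_N) (y : 'cV[P]_N) a b : J a b = 0 ->
  (forall g, inSp g -> x *m Weil g *m y = 0) ->
  forall g, inSp g -> x *m Weil g *m (Z a *m Z b *m y) = 0.
Proof.
move=> Jab h g hg; rewrite mulmxA; apply: texp_coef => c.
have hr := inSp_rootx c Jab.
have [k ->] := Weil_uniqZ hchar hr (texp_intertw Jab c).
by rewrite -scalemxAr -scalemxAl -(mulmxA x) -WeilM // h ?scaler0 //; apply: inSpM.
Qed.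

Lemma Weil_ZZ_r (x : 'rV[P]_N) (y : 'cV[P]_N) a b : J a b = 0 ->
  (forall g, inSp g -> x *m Weil g *m y = 0) ->
  forall g, inSp g -> x *m (Z a *m Z b) *m Weil g *m y = 0.
Proof.
move=> Jab h g hg; rewrite -(mulmxA _ (Weil g)); apply: texp_coef => c.
have hr := inSp_rootx c Jab.
have [k ->] := Weil_uniqZ hchar hr (texp_intertw Jab c).
rewrite -scalemxAr -scalemxAl mulmxA -(mulmxA x) -WeilM // h ?scaler0 //; apply: inSpM => //.
Qed.

Variables (a0 : 'X_{1..n}) (i0 : 'I_n).
Hypothesis ha0 : a0 = 0%MM \/ a0 = U_(i0)%MM.

(** The row vectors annihilating the orbit are stable under quadratic operators. Applying x_i x_j,
    and x_j d/dx_i0 in degree one, reaches all monomials of the parity. *)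
Lemma Weil_cyclic (x : 'rV[P]_N) :
  (forall g, inSp g -> x *m Weil g *m e a0 = 0) ->
  forall a : 'X_{1..n}, inbox p a -> odd (mdeg a) = odd (mdeg a0) -> x *m e a = 0.
Proof.
move=> hx a ha oda.
pose Q (a : 'X_{1..n}) := forall x : 'rV[P]_N, (forall g, inSp g -> x *m Weil g *m e a0 = 0) -> x *m e a = 0.
apply: (mnm_step_ind (Q := Q) ha0) ha oda _ hx.
- by move=> z /(_ _ (inSp1 _ _)); rewrite Weil1 mulmx1.
- move=> {}a i j Qa _ z hz; rewrite -!opX_e (mulmxA (opX _)) mulmxA -!Z_rshift.
  apply: Qa; apply: Weil_ZZ_r => //.
  by rewrite block_mxEdr mxE.
move=> j Q1 z hz; case: (eqVneq j i0) => [->|ji]; first exact: Q1.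
have -> : e U_(j)%MM = opX j *m opD i0 *m e U_(i0)%MM.
  rewrite -mulmxA opD_e // mnm1E eqxx scale1r -[X in (X - _)%MM]add0m addmK.
  by rewrite opX_e add0m.
rewrite mulmxA; apply: Q1; rewrite -Z_lshift -Z_rshift; apply: Weil_ZZ_r => //.
by rewrite block_mxEdl !mxE (negPf ji) mulr0n oppr0.
Qed.

(** On dual vectors a product of two derivations raises exponents; the factors it introduces are
    nonzero as long as the result stays in the box. *)
Lemma Weil_cocyclic (y : 'cV[P]_N) :
  (forall g, inSp g -> es a0 *m Weil g *m y = 0) ->
  forall a : 'X_{1..n}, inbox p a -> odd (mdeg a) = odd (mdeg a0) -> es a *m y = 0.
Proof.
move=> hy a ha oda.
pose Q (a : 'X_{1..n}) :=
  forall y : 'cV[P]_N, (forall g, inSp g -> es a0 *m Weil g *m y = 0) -> es a *m y = 0.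
apply: (mnm_step_ind (Q := Q) ha0) ha oda _ hy.
- by move=> z /(_ _ (inSp1 _ _)); rewrite Weil1 mulmx1.
- move=> {}a i j Qa hin z hz.
  have: es a *m (opD i *m opD j *m z) = 0.
    rewrite -!Z_lshift; apply: Qa; apply: Weil_ZZ_l => //.
    by rewrite block_mxEul mxE.
  rewrite !mulmxA es_opD // -!scalemxAl es_opD // -scalemxAl scalerA => /eqP.
  have nz k : (k.+1 < p)%N -> (k.+1%:R == 0 :> P) = false.
    by move=> kp; apply/negbTE/(nat_pchar_neq0 hchar).
  rewrite scaler_eq0 mulf_eq0 !nz => [/eqP//||].
    by apply: leq_ltn_trans (forallP hin j); rewrite !mnmDE [U_(j)%MM j]mnm1E eqxx addn1.
  apply: leq_ltn_trans (forallP hin i).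
  by rewrite !mnmDE [U_(i)%MM i]mnm1E eqxx addn1 leq_addr.
move=> j Q1 z hz; case: (eqVneq j i0) => [->|ji]; first exact: Q1.
have -> : es U_(j)%MM = es U_(i0)%MM *m (opX i0 *m opD j).
  rewrite mulmxA; have -> : es U_(i0)%MM *m opX i0 = es 0%MM; last by rewrite es0_opD.
  apply: mx_ext => b hb; rewrite -mulmxA opX_e (es_e P hp2 0%MM hb).
  have [hb'|hb'] := boolP (inbox p (b + U_(i0))%MM).
    by rewrite es_e // -{1}[U_(i0)%MM]add0m eqm_add2r.
  rewrite e_out // mulmx0; case: eqP hb' => [<-|_]; last by rewrite raddf0.
  by rewrite add0m inbox1.
rewrite -mulmxA; apply: Q1; rewrite -Z_lshift -Z_rshift; apply: Weil_ZZ_l => //.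
by rewrite block_mxEdl !mxE eq_sym (negPf ji) mulr0n oppr0.
Qed.

End RootElements.

(** * Rational representations of tori *)

Section LaurentFunctions.
Variable P : closedFieldType.

Definition polyfun (F : P -> P) := exists q : {poly P}, forall r, F r = q.[r].
(** The value at 0 is unconstrained, so the notion also fits functions of [r^-1]. *)
Definition laurent (F : P -> P) :=
  exists k (q : {poly P}), forall r, r != 0 -> r ^+ k * F r = q.[r].

Lemma polyfun_const c : polyfun (fun=> c).
Proof. by exists c%:P => r; rewrite hornerC. Qed.
Lemma polyfunD F G : polyfun F -> polyfun G -> polyfun (fun r => F r + G r).
Proof. by move=> [q hq] [s hs]; exists (q + s) => r; rewrite hornerD hq hs. Qed.
Lemma polyfunM F G : polyfun F -> polyfun G -> polyfun (fun r => F r * G r).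
Proof. by move=> [q hq] [s hs]; exists (q * s) => r; rewrite hornerM hq hs. Qed.
Lemma polyfun_ext F G : F =1 G -> polyfun F -> polyfun G.
Proof. by move=> FG [q hq]; exists q => r; rewrite -FG. Qed.

Lemma laurent_const c : laurent (fun=> c).
Proof. by exists 0%N, c%:P => r _; rewrite hornerC expr0 mul1r. Qed.
Lemma laurentM F G : laurent F -> laurent G -> laurent (fun r => F r * G r).
Proof.
move=> [k [q hq]] [l [s hs]]; exists (k + l)%N, (q * s) => r r0.
by rewrite hornerM -hq // -hs // exprD mulrACA.
Qed.
Lemma laurentD F G : laurent F -> laurent G -> laurent (fun r => F r + G r).
Proof.
move=> [k [q hq]] [l [s hs]]; exists (k + l)%N, ('X^l * q + 'X^k * s) => r r0.
by rewrite hornerD !hornerM !hornerXn -hq // -hs // exprD mulrDr;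
  congr (_ + _); rewrite !mulrA //; congr (_ * _); rewrite mulrC.
Qed.
Lemma laurent_ext F G : (forall r, r != 0 -> F r = G r) -> laurent F -> laurent G.
Proof. by move=> FG [k [q hq]]; exists k, q => r r0; rewrite -FG // hq. Qed.

Lemma laurent_expz (z : int) : laurent (fun r => r ^ z).
Proof.
case: z => k; first by exists 0%N, 'X^k => r _; rewrite hornerXn expr0 mul1r.
by exists k.+1, 1 => r r0; rewrite hornerC NegzE -exprnN mulfV // expf_neq0.
Qed.

Lemma laurent_sum (I : Type) (s : seq I) (F : I -> P -> P) :
  (forall i, laurent (F i)) -> laurent (fun r => \sum_(i <- s) F i r).
Proof.
move=> hF; elim: s => [|i s IH].
  by apply: laurent_ext (laurent_const 0) => r _; rewrite big_nil.
by apply: laurent_ext (laurentD (hF i) IH) => r _; rewrite big_cons.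
Qed.

Lemma laurent_mulmx a b c (A : P -> 'M[P]_(a, b)) (B : P -> 'M[P]_(b, c)) :
  (forall i j, laurent (fun r => A r i j)) -> (forall i j, laurent (fun r => B r i j)) ->
  forall i j, laurent (fun r => (A r *m B r) i j).
Proof.
move=> hA hB i j.
apply: (laurent_ext (F := fun r => \sum_k A r i k * B r k j)) => [r _|].
  by rewrite mxE.
by apply: laurent_sum => k; apply: laurentM.
Qed.

Lemma laurent_eq F G (Q : {poly P}) : laurent F -> laurent G -> Q != 0 ->
  (forall r, r != 0 -> Q.[r] != 0 -> F r = G r) -> forall r, r != 0 -> F r = G r.
Proof.
move=> [k [q hq]] [l [s hs]] Q0 FG r r0.
have E : 'X^l * q = 'X^k * s.
  apply: (@poly_eq_generic _ ('X * Q)); first by rewrite mulf_neq0 ?polyX_eq0.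
  move=> t; rewrite hornerM hornerX mulf_eq0 negb_or => /andP[t0 Qt].
  by rewrite !hornerM !hornerXn -hq // -hs // FG // mulrCA.
have := congr1 (fun q : {poly P} => q.[r]) E.
rewrite !hornerM !hornerXn -hq // -hs // mulrCA => E2.
have rk : r ^+ k != 0 by rewrite expf_neq0.
have rl : r ^+ l != 0 by rewrite expf_neq0.
by apply: (mulfI rl); apply: (mulfI rk).
Qed.

(** Stated for an abstract class of functions, to serve polynomial and Laurent functions alike. *)
Lemma meval_closed (K : (P -> P) -> Prop) :
  (forall c, K (fun=> c)) ->
  (forall F G, K F -> K G -> K (fun r => F r + G r)) ->
  (forall F G, K F -> K G -> K (fun r => F r * G r)) ->
  (forall F G, F =1 G -> K F -> K G) ->
  forall k (Q : {mpoly P[k]}) (v : P -> 'I_k -> P), (forall i, K (fun r => v r i)) ->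
  K (fun r => Q.@[v r]).
Proof.
move=> Kc KD KM Kext k Q v hv.
have KX F j : K F -> K (fun r => F r ^+ j).
  move=> hF; elim: j => [|j IH]; first by apply: Kext (Kc 1) => r; rewrite expr0.
  by apply: Kext (KM _ _ hF IH) => r; rewrite exprS.
have Kp (s : seq 'I_k) (m : 'X_{1..k}) : K (fun r => \prod_(i <- s) v r i ^+ m i).
  elim: s => [|i s IH]; first by apply: Kext (Kc 1) => r; rewrite big_nil.
  by apply: Kext (KM _ _ (KX _ (m i) (hv i)) IH) => r; rewrite big_cons.
suff Ks (s : seq 'X_{1..k}) : K (fun r => \sum_(m <- s) Q@_m * \prod_i v r i ^+ m i).
  by apply: Kext (Ks (msupp Q)) => r; rewrite mevalE.
elim: s => [|m s IH]; first by apply: Kext (Kc 0) => r; rewrite big_nil.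
by apply: Kext (KD _ _ (KM _ _ (Kc Q@_m) (Kp _ m)) IH) => r; rewrite big_cons.
Qed.

Lemma expz_generic (z1 z2 : int) : z1 != z2 -> exists2 r : P, r != 0 & r ^ z1 != r ^ z2.
Proof.
move=> z12; pose k := `|z1 - z2|%N.
have k0 : (0 < k)%N by rewrite absz_gt0 subr_eq0.
have Q0 : 'X * ('X^k - 1) != 0 :> {poly P}.
  by rewrite mulf_neq0 ?polyX_eq0 // -size_poly_eq0 size_XnsubC.
have [r] := generic_point Q0; rewrite hornerM hornerX mulf_eq0 negb_or => /andP[r0].
rewrite !hornerE => rk; exists r => //; apply: contraNneq rk => E.
have : r ^ (z1 - z2) = 1 by rewrite expfzDr // E -expfzDr // subrr expr0z.
rewrite /k; case: (z1 - z2) => m /=; first by rewrite -exprnP => ->; rewrite subrr.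
rewrite NegzE -exprnN => /(congr1 GRing.inv); rewrite invrK invr1 => ->.
by rewrite subrr.
Qed.

Lemma mx_poly_eq a b d (A B : nat -> 'M[P]_(a, b)) :
  (forall r, r != 0 -> \sum_(j < d) r ^+ j *: A j = \sum_(j < d) r ^+ j *: B j) ->
  forall j, (j < d)%N -> A j = B j.
Proof.
move=> AB j jd; apply/matrixP => i k.
have E : \poly_(j < d) A j i k = \poly_(j < d) B j i k.
  apply: poly_eq_pos => r r0; rewrite !horner_poly.
  have /matrixP/(_ i k) := AB r r0; rewrite !summxE => E.
  by transitivity (\sum_(j < d) (r ^+ j *: A j) i k); [|rewrite E];
    apply: eq_bigr => l _; rewrite mxE mulrC.
by have := congr1 (fun q : {poly P} => q`_j) E; rewrite !coef_poly jd.
Qed.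

(* [r^-j0 * sum_j r^j A_j] has only nonpositive powers of [r] and extends to
   [r = 0], so it is constant. *)
Lemma mx_poly_lim a b d j0 (A : nat -> 'M[P]_(a, b)) (G : P -> 'M[P]_(a, b)) :
  (j0 < d)%N -> (forall i k, polyfun (fun r => G r i k)) ->
  (forall j, (j0 < j)%N -> (j < d)%N -> A j = 0) ->
  (forall r, r != 0 -> \sum_(j < d) r ^+ j *: A j = r ^+ j0 *: G r) ->
  \sum_(j < d) A j = G 0.
Proof.
move=> j0d hG Abig AG; apply/matrixP => i k.
have [q hq] := hG i k.
have E : \poly_(j < d) A j i k = 'X^j0 * q.
  apply: poly_eq_pos => r r0; rewrite hornerM hornerXn horner_poly -hq.
  have /matrixP/(_ i k) := AG r r0; rewrite summxE [RHS]mxE => <-.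
  by apply: eq_bigr => l _; rewrite mxE mulrC.
have Aj j : (j < d)%N -> A j i k = ('X^j0 * q)`_j by move=> jd; rewrite -E coef_poly jd.
rewrite summxE (bigD1 (Ordinal j0d)) //= big1 ?addr0 => [|j jj0].
  by rewrite Aj // coefXnM ltnn subnn hq horner_coef0.
have [jlt|jge] := ltnP j j0; first by rewrite Aj // coefXnM jlt.
by rewrite Abig ?mxE // ltn_neqAle jge andbT eq_sym.
Qed.

(** Multiplied by a common [r ^+ N], [theta] becomes a polynomial with matrix coefficients [C j].
    Comparing coefficients in [theta (r * s) = theta r *m theta s] shows that [C j] is the
    projection onto the space of weight [j - N]. *)
Lemma torus1_decomp m (theta : P -> 'M[P]_m) :
  theta 1 = 1%:M ->
  (forall r s, r != 0 -> s != 0 -> theta (r * s) = theta r *m theta s) ->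
  (forall i j, laurent (fun r => theta r i j)) ->
  exists (N d : nat) (C : nat -> 'M[P]_m),
  [/\ \sum_(j < d) C j = 1%:M,
      forall r, r != 0 -> r ^+ N *: theta r = \sum_(j < d) r ^+ j *: C j,
      forall r j, r != 0 -> (j < d)%N -> theta r *m C j = (r ^ (j%:Z - N%:Z)) *: C j,
      forall r j, r != 0 -> (j < d)%N -> C j *m theta r = (r ^ (j%:Z - N%:Z)) *: C j
    & forall A : 'M_m, (forall r, r != 0 -> A *m theta r = theta r *m A) ->
        forall j, (j < d)%N -> A *m C j = C j *m A].
Proof.
move=> th1 thM thL.
have [K hK] := @fin_all_exists ('I_m * 'I_m)%type (fun=> nat) (fun x k =>
  exists q : {poly P}, forall r, r != 0 -> r ^+ k * theta r x.1 x.2 = q.[r])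
  (fun x => thL x.1 x.2).
have [q hq] := fin_all_exists hK.
pose N := \sum_x K x.
pose q' x := 'X^(N - K x) * q x.
have KN x : (K x <= N)%N by rewrite /N (bigD1 x) //= leq_addr.
have hq' r i k : r != 0 -> r ^+ N * theta r i k = (q' (i, k)).[r].
  move=> r0; rewrite hornerM hornerXn -(hq (i, k)) // mulrA -exprD subnK //.
pose d := \max_x size (q' x).
pose C j : 'M[P]_m := \matrix_(i, k) (q' (i, k))`_j.
have thE r : r != 0 -> r ^+ N *: theta r = \sum_(j < d) r ^+ j *: C j.
  move=> r0; apply/matrixP => i k; rewrite mxE hq' // summxE.
  have sz : (size (q' (i, k)) <= d)%N by apply: (leq_bigmax (F := fun x => size (q' x))).
  rewrite (horner_coef_wide _ sz).
  by apply: eq_bigr => j _; rewrite !mxE mulrC.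
have nz (s : P) : s != 0 -> s ^+ N != 0 by move=> s0; rewrite expf_neq0.
have ex (s : P) j : s != 0 -> s ^ (j%:Z - N%:Z) = (s ^+ N)^-1 * s ^+ j.
  move=> s0.
  by rewrite expfzDr // -exprnN mulrC.
exists N, d, C; split=> //.
- by have := thE 1 (oner_neq0 _); rewrite expr1n scale1r th1 => ->;
    apply: eq_bigr => j _; rewrite expr1n scale1r.
- move=> s j s0 jd; suff E : (s ^+ N *: theta s) *m C j = s ^+ j *: C j.
    by rewrite ex // -scalerA -E -scalemxAl scalerA mulVf ?nz // scale1r.
  apply: (@mx_poly_eq m m d (fun j => (s ^+ N *: theta s) *m C j) (fun j => s ^+ j *: C j) _ j jd) => r r0.
  under [RHS]eq_bigr => l _ do rewrite scalerA -exprMn.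
  rewrite -thE ?mulf_neq0 // [r * s]mulrC thM // exprMn -scalerA scalemxAr (thE r) //.
  rewrite scalemxAl mulmx_sumr; apply: eq_bigr => l _.
  by rewrite scalemxAr.
- move=> s j s0 jd; suff E : C j *m (s ^+ N *: theta s) = s ^+ j *: C j.
    by rewrite ex // -scalerA -E -scalemxAr scalerA mulVf ?nz // scale1r.
  apply: (@mx_poly_eq m m d (fun j => C j *m (s ^+ N *: theta s)) (fun j => s ^+ j *: C j) _ j jd) => r r0.
  under [RHS]eq_bigr => l _ do rewrite scalerA -exprMn.
  rewrite -thE ?mulf_neq0 // thM // exprMn -scalerA scalemxAr scalemxAl (thE r) //.
  by rewrite mulmx_suml; apply: eq_bigr => l _; rewrite -scalemxAl.
move=> A hA j jd; apply: (@mx_poly_eq m m d (fun j => A *m C j) (fun j => C j *m A)) jd.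
move=> r r0; under eq_bigr => l _ do rewrite scalemxAr.
rewrite -mulmx_sumr -thE // -scalemxAr hA // scalemxAl thE // mulmx_suml.
by apply: eq_bigr => l _; rewrite scalemxAl.
Qed.

End LaurentFunctions.

(** * Heights and the dominance order *)

Section Height.
Variable n : nat.
Implicit Types chi mu lam : 'I_n -> int.

(** The exponent of the character on the one-parameter subgroup [tau]. *)
Definition height chi : int := \sum_i chi i * (n - i)%:Z.

Lemma height_simple_root_gt0 (i : 'I_n) : 0 < height (simple_root i).
Proof.
rewrite /height /simple_root; case: ltnP => hi; rewrite (bigD1 i) //=.
  rewrite (bigD1 (Ordinal hi)) /=; last by rewrite -val_eqE /= gtn_eqF.
  rewrite big1 => [|j /andP[ji ji1]].
    by rewrite !eqxx ltn_eqF // gtn_eqF //; have := ltn_ord i; lia.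
  by rewrite !(val_eqE j i) (negPf ji) -(val_eqE j (Ordinal hi)) /= in ji1 *; rewrite (negPf ji1) mul0r.
rewrite eqxx big1 => [|j ji]; first by have := ltn_ord i; lia.
by rewrite (val_eqE j i) (negPf ji) mulr0 mul0r.
Qed.

(** Every simple root has positive height, so equal heights force all the coefficients [c i] to
    vanish. *)
Lemma height_dom_le mu lam : dom_le mu lam ->
  height mu <= height lam /\ (height mu = height lam -> mu =1 lam).
Proof.
move=> [c hc].
have E : height lam - height mu = \sum_i (c i)%:Z * height (simple_root i).
  rewrite /height -sumrB.
  transitivity (\sum_j \sum_i (c i)%:Z * (simple_root i j * (n - j)%:Z)).
    by apply: eq_bigr => j _; rewrite -mulrBl hc mulr_suml; apply: eq_bigr => i _; rewrite mulrA.
  by rewrite exchange_big; apply: eq_bigr => i _; rewrite mulr_sumr.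
have ge0 i : 0 <= (c i)%:Z * height (simple_root i).
  by rewrite mulr_ge0 // ltW // height_simple_root_gt0.
split; first by rewrite -subr_ge0 E sumr_ge0.
move=> /eqP; rewrite eq_sym -subr_eq0 E psumr_eq0 // => /allP h0 j.
apply/eqP; rewrite eq_sym -subr_eq0 hc big1 // => i _.
have := h0 i (mem_index_enum i); rewrite implyTb mulf_eq0.
by rewrite (gt_eqF (height_simple_root_gt0 i)) orbF => /eqP ->; rewrite mul0r.
Qed.

End Height.

(** * Rational representations restricted to curves and to the torus *)

Section RationalRep.
Variables (P : closedFieldType) (n m : nat) (rho : 'M[P]_(n + n) -> 'M[P]_m).
Hypothesis hrat : is_rational_rep rho.

Lemma rho1 : rho 1%:M = 1%:M. Proof. by case: hrat. Qed.

Lemma rhoM g h : inSp g -> inSp h -> rho (g *m h) = rho g *m rho h.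
Proof. by case: hrat => _ + _; apply. Qed.

Lemma rho_polyfun (gam : P -> 'M[P]_(n + n)) : (forall r, inSp (gam r)) ->
  (forall a b, polyfun (fun r => gam r a b)) -> forall i j, polyfun (fun r => rho (gam r) i j).
Proof.
move=> hg hp i j; case: hrat => _ _ [Q hQ].
apply: (polyfun_ext (F := fun r => (Q i j).@[fun k => mxvec (gam r) 0 k])).
  by move=> r; rewrite hQ.
apply: (@meval_closed P (@polyfun P)).
- exact: polyfun_const.
- exact: polyfunD.
- exact: polyfunM.
- exact: polyfun_ext.
move=> k; case/mxvec_indexP: k => a b.
by apply: polyfun_ext (hp a b) => r; rewrite mxvecE.
Qed.

Lemma rho_laurent (gam : P -> 'M[P]_(n + n)) : (forall r, r != 0 -> inSp (gam r)) ->
  (forall a b, laurent (fun r => gam r a b)) -> forall i j, laurent (fun r => rho (gam r) i j).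
Proof.
move=> hg hp i j; case: hrat => _ _ [Q hQ].
apply: (laurent_ext (F := fun r => (Q i j).@[fun k => mxvec (gam r) 0 k])).
  by move=> r r0; rewrite hQ //; apply: hg.
apply: (@meval_closed P (@laurent P)).
- exact: laurent_const.
- exact: laurentD.
- exact: laurentM.
- by move=> F G FG; apply: laurent_ext => r _.
move=> k; case/mxvec_indexP: k => a b.
by apply: laurent_ext (hp a b) => r _; rewrite mxvecE.
Qed.

Lemma torus_eltM (t s : 'I_n -> P) :
  torus_elt (fun i => t i * s i) = torus_elt t *m torus_elt s.
Proof.
rewrite mulmx_block !(mulmx0, mul0mx, addr0, add0r) !mulmx_diag.
by congr (block_mx (diag_mx _) _ _ (diag_mx _)); apply/matrixP => i j; rewrite !mxE ?invfM.
Qed.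

Lemma torus_elt_ext (t s : 'I_n -> P) : t =1 s -> torus_elt t = torus_elt s.
Proof.
by move=> ts; congr (block_mx (diag_mx _) _ _ (diag_mx _));
  apply/matrixP => i j; rewrite !mxE ts.
Qed.

Lemma torus_elt1 : torus_elt (fun _ : 'I_n => 1 : P) = 1%:M.
Proof.
rewrite (scalar_mx_block n n); congr (block_mx _ _ _ _);
  by apply/matrixP => i j; rewrite !mxE ?invr1.
Qed.

Lemma torus_comm (t s : 'I_n -> P) : (forall i, t i != 0) -> (forall i, s i != 0) ->
  rho (torus_elt t) *m rho (torus_elt s) = rho (torus_elt s) *m rho (torus_elt t).
Proof.
move=> ht hs; rewrite -!rhoM; try exact: inSp_torus.
by rewrite -!torus_eltM; congr rho; apply: torus_elt_ext => i; rewrite mulrC.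
Qed.

Definition coord (i : 'I_n) (r : P) : 'I_n -> P := fun j => if j == i then r else 1.

Lemma coord_neq0 i r : r != 0 -> forall j, coord i r j != 0.
Proof. by move=> r0 j; rewrite /coord; case: ifP; rewrite ?oner_eq0. Qed.

Lemma torus_laurent (t : P -> 'I_n -> P) :
  (forall r, r != 0 -> forall i, t r i != 0) ->
  (forall i, laurent (fun r => t r i)) -> (forall i, laurent (fun r => (t r i)^-1)) ->
  forall i j, laurent (fun r => rho (torus_elt (t r)) i j).
Proof.
move=> t0 ht htV; apply: rho_laurent => [r r0|a b]; first exact: inSp_torus (t0 r r0).
have L0 := laurent_const (0 : P).
case: (split_ordP a) => i ->; case: (split_ordP b) => j ->.
- apply: (laurent_ext (F := fun r => t r i * (i == j)%:R)) => [r _|].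
    by rewrite block_mxEul !mxE mulr_natr.
  by apply: laurentM => //; apply: laurent_const.
- by apply: laurent_ext L0 => r _; rewrite block_mxEur mxE.
- by apply: laurent_ext L0 => r _; rewrite block_mxEdl mxE.
apply: (laurent_ext (F := fun r => (t r i)^-1 * (i == j)%:R)) => [r _|].
  by rewrite block_mxEdr !mxE mulr_natr.
by apply: laurentM => //; apply: laurent_const.
Qed.

(** Every vector is a sum of weight vectors. The vector is split for one coordinate torus at a time;
    its projections commute with the other coordinates, so the characters already obtained
    survive. *)
Lemma weight_vec_ind (Q : 'cV[P]_m -> Prop) :
  Q 0 -> (forall x y, Q x -> Q y -> Q (x + y)) ->
  (forall chi x, is_weight_vec rho chi x -> Q x) -> forall x, Q x.
Proof.
move=> Q0 QD QW.
suff main k : (k <= n)%N -> forall x, (exists mu : 'I_n -> int, forall i : 'I_n,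
    (i < n - k)%N -> forall r, r != 0 -> rho (torus_elt (coord i r)) *m x = r ^ (mu i) *: x) -> Q x.
  by move=> x; apply: (main n (leqnn n)); exists (fun=> 0) => i; rewrite subnn ltn0.
elim: k => [|k IH] kn x [mu hmu].
  apply: (QW mu) => t ht.
  (* [s j] keeps the first [j] coordinates of [t], so that the torus element is assembled from
     one-coordinate ones. *)
  pose s j : 'I_n -> P := fun i => if (i < j)%N then t i else 1.
  have s0 j i : s j i != 0 by rewrite /s; case: ifP; rewrite ?oner_eq0.
  have main j : (j <= n)%N -> rho (torus_elt (s j)) *m x =
      (\prod_(i : 'I_n | (i < j)%N) t i ^ mu i) *: x.
    elim: j => [|j IHj] jn.
      by rewrite big_pred0 // (torus_elt_ext (s := fun=> 1)) // torus_elt1 rho1 mul1mx scale1r.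
    pose j' := Ordinal jn.
    rewrite (torus_elt_ext (s := fun i => coord j' (t j') i * s j i)) => [|i]; last first.
      rewrite /coord /s ltnS leq_eqVlt; case: (eqVneq i j') => [->|ij].
        by rewrite /= eqxx ltnn mulr1.
      by rewrite mul1r -[(i : nat) == j]/(i == j') (negPf ij).
    rewrite torus_eltM rhoM; try by apply: inSp_torus => // i; apply: coord_neq0.
    rewrite -mulmxA IHj ?(ltnW jn) // -scalemxAr hmu ?subn0 // scalerA; congr (_ *: _).
    rewrite [RHS](bigD1 j') //= mulrC; congr (_ * _); apply: eq_bigl => i.
    by rewrite ltnS ltn_neqAle andbC.
  rewrite (torus_elt_ext (s := s n)) => [|i]; last by rewrite /s ltn_ord.
  by rewrite main //; congr (_ *: _); apply: eq_bigl => i; rewrite ltn_ord.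
have ik : (n - k.+1 < n)%N by rewrite ltn_subrL (leq_ltn_trans _ kn).
pose i0 := Ordinal ik.
have [|r s r0 s0|i j|N [d [C [C1 CE thC _ Ccomm]]]] :=
  torus1_decomp (theta := fun r => rho (torus_elt (coord i0 r))).
- rewrite (torus_elt_ext (s := fun=> 1)) ?torus_elt1 ?rho1 // => i.
  by rewrite /coord; case: ifP.
- rewrite -rhoM; try by apply: inSp_torus => // i; apply: coord_neq0.
  rewrite -torus_eltM; congr rho; apply: torus_elt_ext => i.
  by rewrite /coord; case: ifP; rewrite ?mulr1.
- apply: torus_laurent => [r r0 i'|i'|i']; first exact: coord_neq0.
    rewrite /coord; case: (i' == i0); last exact: laurent_const.
    by apply: laurent_ext (laurent_expz P 1).
  rewrite /coord; case: (i' == i0); last by apply: laurent_ext (laurent_const 1) => r _; rewrite invr1.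
  by apply: laurent_ext (laurent_expz P (- 1)) => r _; rewrite exprN1.
rewrite -[x]mul1mx -C1 mulmx_suml; apply: big_ind => // -[j jd] _ /=.
apply: IH (ltnW kn) _ _.
exists (fun i => if i == i0 then j%:Z - N%:Z else mu i) => i ik' r r0.
case: eqP => [->|/eqP ii0]; first by rewrite mulmxA thC // scalemxAl.
rewrite mulmxA Ccomm // => [|s s0]; last first.
  by apply: torus_comm; apply: coord_neq0.
rewrite -mulmxA hmu ?scalemxAr //.
move: ik'; rewrite -val_eqE /= in ii0; rewrite subnS; move: ii0; rewrite subnS; lia.
Qed.

Lemma char_val_tau (chi : 'I_n -> int) (r : P) : r != 0 ->
  char_val chi (fun i : 'I_n => r ^+ (n - i)) = r ^ (height chi).
Proof.
move=> r0; rewrite /height -prod_expz_sum //; apply: eq_bigr => i _.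
by rewrite exprnP exprz_exp mulrC.
Qed.

Lemma rho_tau_weight chi x r : is_weight_vec rho chi x -> r != 0 ->
  rho (tau n r) *m x = r ^ (height chi) *: x.
Proof.
by move=> hx r0; rewrite -char_val_tau //; apply: hx => i; apply: expf_neq0.
Qed.

Lemma tau_laurent i j : laurent (fun r => rho (tau n r) i j).
Proof.
apply: torus_laurent => [r r0 k|k|k]; first exact: expf_neq0.
  by apply: laurent_ext (laurent_expz P (n - k)%:Z).
by apply: laurent_ext (laurent_expz P (- (n - k)%:Z)) => r _; rewrite exprnN.
Qed.

Lemma tauV_laurent i j : laurent (fun r => rho (tau n r^-1) i j).
Proof.
apply: torus_laurent => [r r0 k|k|k]; first by rewrite expf_neq0 ?invr_eq0.
  by apply: laurent_ext (laurent_expz P (- (n - k)%:Z)) => r _; rewrite exprVn exprnN.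
by apply: laurent_ext (laurent_expz P (n - k)%:Z) => r _; rewrite exprVn invrK.
Qed.

End RationalRep.

(** * Matrix coefficients of highest weight vectors *)

Section HighestWeightData.
Variables (P : closedFieldType) (n : nat).
Local Notation G := 'M[P]_(n + n).

(* A highest weight vector [v] and a dual one [vs], normalized by [vs v = 1]. *)
Record hw_data (chi : 'I_n -> int) k (sig : G -> 'M[P]_k) (v : 'cV[P]_k) (vs : 'rV[P]_k) : Prop := HwData {
  hw_1 : sig 1%:M = 1%:M;
  hw_M : forall g h, inSp g -> inSp h -> sig (g *m h) = sig g *m sig h;
  hw_torus : forall t, (forall i, t i != 0) -> sig (torus_elt t) *m v = char_val chi t *: v;
  hw_torus_dual : forall t, (forall i, t i != 0) -> vs *m sig (torus_elt t) = char_val chi t *: vs;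
  hw_up : forall u, inSp u -> uptri u -> sig u *m v = v;
  hw_dn : forall l, inSp l -> dntri l -> vs *m sig l = vs;
  hw_pairing : vs *m v = 1%:M;
  hw_tau : forall i j, laurent (fun r => sig (tau n r) i j);
  hw_tauV : forall i j, laurent (fun r => sig (tau n r^-1) i j)
}.

Definition hw_coef k (sig : G -> 'M[P]_k) v vs g : P := (vs *m sig g *m v : 'M_1) 0 0.

Lemma hw_coef_Gauss chi k (sig : G -> 'M[P]_k) v vs l t u : hw_data chi sig v vs ->
  inSp l -> dntri l -> (forall i, t i != 0) -> inSp u -> uptri u ->
  hw_coef sig v vs (l *m torus_elt t *m u) = char_val chi t.
Proof.
move=> D hl tl ht hu tu; have hT := inSp_torus ht.
rewrite /hw_coef !(hw_M D) //; last exact: inSpM.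
rewrite !mulmxA (hw_dn D) // (hw_torus_dual D) // -!scalemxAl -mulmxA (hw_up D) //.
by rewrite (hw_pairing D) scale_scalar_mx mulr1 mxE eqxx.
Qed.

Lemma hw_coef_Gauss2 chi k (sig : G -> 'M[P]_k) v vs l t u l' t' u' : hw_data chi sig v vs ->
  inSp l -> dntri l -> (forall i, t i != 0) -> inSp u ->
  inSp l' -> (forall i, t' i != 0) -> inSp u' -> uptri u' ->
  hw_coef sig v vs ((l *m torus_elt t *m u) *m (l' *m torus_elt t' *m u')) =
  char_val chi t * hw_coef sig v vs (u *m l') * char_val chi t'.
Proof.
move=> D hl tl ht hu hl' ht' hu' tu'; have hT := inSp_torus ht; have hT' := inSp_torus ht'.
rewrite /hw_coef !(hw_M D) //; try by do ?[apply: inSpM].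
rewrite !mulmxA (hw_dn D) // (hw_torus_dual D) // -!scalemxAl -!(mulmxA _ (sig u') v) (hw_up D) //.
rewrite -!(mulmxA _ (sig (torus_elt t')) v) (hw_torus D) // -!scalemxAr scalerA.
by rewrite mxE mulrAC.
Qed.

(** Since [curve l r] is the conjugate of [l] by [tau], the variable enters only through the
    matrices of [tau n r] and [tau n r^-1]. *)
Lemma hw_coef_curve chi k (sig : G -> 'M[P]_k) v vs u l : hw_data chi sig v vs ->
  inSp u -> inSp l -> dntri l -> laurent (fun r => hw_coef sig v vs (u *m curve l r)).
Proof.
move=> D hu hl tl.
have L a b (A : 'M[P]_(a, b)) i j : laurent (fun=> A i j) by apply: laurent_const.
apply: (laurent_ext (F := fun r =>
   (vs *m sig u *m sig (tau n r^-1) *m (sig l *m sig (tau n r) *m v) : 'M_1) 0 0)).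
  move=> r r0; have rV0 : r^-1 != 0 by rewrite invr_neq0.
  have ht := inSp_tau n r0; have htV := inSp_tau n rV0.
  have -> : curve l r = tau n r^-1 *m (l *m tau n r).
    rewrite -curve_dn // mulmxA -tauM mulVf // tau1 mul1mx //.
  by rewrite /hw_coef !(hw_M D) // ?mulmxA //; do ?[apply: inSpM].
apply: (laurent_mulmx (A := fun r => vs *m sig u *m sig (tau n r^-1))
  (B := fun r => sig l *m sig (tau n r) *m v)) => i j.
  by apply: (laurent_mulmx (A := fun=> vs *m sig u)); [move=> ? ?; apply: L | apply: hw_tauV D].
apply: (laurent_mulmx (A := fun r => sig l *m sig (tau n r)) (B := fun=> v)) => i' j'; last exact: L.
by apply: (laurent_mulmx (A := fun=> sig l)); [move=> ? ?; apply: L | apply: hw_tau D].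
Qed.

Lemma hw_coef_eq chi k1 k2 (s1 : G -> 'M[P]_k1) (s2 : G -> 'M[P]_k2) v1 vs1 v2 vs2 g :
  hw_data chi s1 v1 vs1 -> hw_data chi s2 v2 vs2 -> inSp g ->
  hw_coef s1 v1 vs1 g = hw_coef s2 v2 vs2 g.
Proof.
move=> D1 D2 hg; have [g1 [g2 [h1 h2 [l [t [u]]]]]] := inSp_Gauss_mul hg.
move=> [[hl tl] [hu tu] ht ->] [l' [t' [u' [[hl' tl'] [hu' tu'] ht' ->]]]] ->.
rewrite (hw_coef_Gauss2 D1) // (hw_coef_Gauss2 D2) //; congr (_ * _ * _).
(* The curve passes through [l'] at [r = 1]; for generic [r] the product lies in the big cell, where
   both coefficients are the same character value. *)
have c1 : curve l' 1 = l' by apply/matrixP => a b; rewrite curveE expr1n mulr1.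
have [Q Q0 QG] := Gauss_curve hu tu hl' tl'.
rewrite -c1; apply: (laurent_eq (hw_coef_curve D1 hu hl' tl') (hw_coef_curve D2 hu hl' tl') Q0).
  move=> r r0 /QG [l2 [t2 [u2 [[hl2 tl2] [hu2 tu2] ht2 ->]]]].
  by rewrite (hw_coef_Gauss D1) // (hw_coef_Gauss D2).
exact: oner_neq0.
Qed.

End HighestWeightData.

(** * Highest weight vectors of a rational representation *)

Section RationalHighestWeight.
Variables (P : closedFieldType) (n m : nat) (rho : 'M[P]_(n + n) -> 'M[P]_m).
Variable (lam : 'I_n -> int).
Hypotheses (hrat : is_rational_rep rho) (hlam : has_highest_weight rho lam).

(** The dual vector is any linear form with value 1 at [v], preceded by the projection [E] onto the
    top weight space of [tau]. Invariance under the unipotent groups is a limit along [tau]: no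
    higher power of [r] can occur. *)
Lemma rational_hw_data : exists v vs, hw_data lam rho v vs.
Proof.
have [[v [v0 hv]] hdom] := hlam.
have rM := rhoM hrat.
have tauM' (r s : P) : r != 0 -> s != 0 -> rho (tau n (r * s)) = rho (tau n r) *m rho (tau n s).
  by move=> r0 s0; rewrite tauM rM //; apply: inSp_tau.
have [|N [d [C [C1 CE thC Cth Ccomm]]]] := torus1_decomp _ tauM' (tau_laurent hrat).
  by rewrite tau1 rho1.
have Cw chi x j : is_weight_vec rho chi x -> (j < d)%N -> j%:Z - N%:Z != height chi ->
    C j *m x = 0.
  move=> hx jd jh; have [r r0 rz] := expz_generic P jh.
  have : (r ^ (j%:Z - N%:Z) - r ^ height chi) *: (C j *m x) = 0.
    by rewrite scalerBl scalemxAl -Cth // -mulmxA (rho_tau_weight hx) // -scalemxAr subrr.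
  by move/eqP; rewrite scaler_eq0 subr_eq0 (negPf rz) => /eqP.
have [j0 [j0d j0E]] : exists j0, (j0 < d)%N /\ j0%:Z - N%:Z = height lam.
  apply: NNPP => h; case/eqP: v0; rewrite -[v]mul1mx -C1 mulmx_suml big1 // => -[j jd] _ /=.
  by apply: (Cw lam) => //; apply/eqP => E; apply: h; exists j.
pose E := C j0.
have hwle chi x : is_weight_vec rho chi x -> x != 0 ->
    height chi <= height lam /\ (height chi = height lam -> chi =1 lam).
  by move=> hx x0; apply/height_dom_le/hdom; exists x.
have Cbig j (x : 'cV[P]_m) : (j0 < j)%N -> (j < d)%N -> C j *m x = 0.
  move=> jj0 jd; apply: (weight_vec_ind hrat (Q := fun x => C j *m x = 0)).
  - by rewrite mulmx0.
  - by move=> y z hy hz; rewrite mulmxDr hy hz addr0.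
  move=> chi y hy; case: (eqVneq y 0) => [->|y0]; first by rewrite mulmx0.
  have [le _] := hwle _ _ hy y0; apply: (Cw chi) => //.
  by apply/eqP => E2; move: le j0E E2 jj0; lia.
have Cbig0 j : (j0 < j)%N -> (j < d)%N -> C j = 0.
  move=> jj0 jd; apply/matrixP => a b; rewrite [RHS]mxE.
  have /matrixP/(_ a 0) := Cbig j (delta_mx b 0) jj0 jd.
  by rewrite -colE !mxE.
have Ev : E *m v = v.
  rewrite -[RHS]mul1mx -C1 mulmx_suml (bigD1 (Ordinal j0d)) //= big1 ?addr0 // => -[j jd] jj0.
  by apply: (Cw lam) => //=; rewrite -j0E; move: jj0; rewrite -val_eqE /=; lia.
have tauC (t : 'I_n -> P) : (forall i, t i != 0) -> rho (torus_elt t) *m E = E *m rho (torus_elt t).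
  by move=> ht; apply: Ccomm => // r r0; apply: torus_comm => // i; apply: expf_neq0.
(* A weight of the same height as [lam] is [lam], so the top [tau]-component is a weight space of
   the whole torus. *)
have ET (x : 'cV[P]_m) (t : 'I_n -> P) : (forall i, t i != 0) ->
    rho (torus_elt t) *m (E *m x) = char_val lam t *: (E *m x).
  move=> ht; apply: (weight_vec_ind hrat
    (Q := fun x => rho (torus_elt t) *m (E *m x) = char_val lam t *: (E *m x))).
  - by rewrite !mulmx0 scaler0.
  - by move=> y z hy hz; rewrite !mulmxDr hy hz scalerDr.
  move=> chi y hy; case: (eqVneq y 0) => [->|y0]; first by rewrite !mulmx0 scaler0.
  have [_ heq] := hwle _ _ hy y0.
  case: (eqVneq (height chi) (height lam)) => [/heq cl|ne].
    rewrite mulmxA tauC // -mulmxA hy // -scalemxAr; congr (_ *: _).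
    by apply: eq_bigr => i _; rewrite cl.
  by rewrite (Cw chi) // ?mulmx0 ?scaler0 // j0E eq_sym.
have ETm (t : 'I_n -> P) : (forall i, t i != 0) -> rho (torus_elt t) *m E = char_val lam t *: E.
  move=> ht; apply/matrixP => a b; have /matrixP/(_ a 0) := ET (delta_mx b 0) t ht.
  by rewrite mulmxA scalemxAl -!colE !mxE.
have [xi hxi] : exists xi : 'rV[P]_m, xi *m v = 1%:M.
  have [i vi] : exists i, v i 0 != 0.
    apply: NNPP => h; case/eqP: v0; apply/colP => i; rewrite mxE.
    by apply/eqP; apply: contraT => vi; case: h; exists i.
  exists ((v i 0)^-1 *: delta_mx 0 i); rewrite -scalemxAl -rowE.
  by apply/matrixP => a b; rewrite !ord1 !mxE mulVf.
have sumC_sub a b (A : nat -> 'M[P]_(a, b)) (Gf : P -> 'M[P]_(a, b)) := @mx_poly_lim P a b d j0 A Gf j0d.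
have powE (r : P) : r != 0 -> r ^+ N * r ^ (height lam) = r ^+ j0.
  by move=> r0; rewrite exprnP -expfzDr // -j0E addrC subrK.
exists v, (xi *m E); split.
- exact: rho1.
- exact: rM.
- by move=> t ht; apply: hv.
- by move=> t ht; rewrite -mulmxA -tauC // ETm // scalemxAr.
(* [tau r] applied to [u v] is [curve u r] applied to [v], times the top power of [r]; the limit is
   taken at [r = 0], where the curve is 1. *)
- move=> u hu tu.
  have cu r : inSp (curve u r) by apply: inSp_curve_up.
  rewrite -[LHS]mul1mx -C1 mulmx_suml.
  rewrite (sumC_sub _ _ (fun j => C j *m (rho u *m v)) (fun r => rho (curve u r) *m v)).
  + by rewrite curve0_up // rho1 // mul1mx.
  + move=> i k; apply: (polyfun_ext (F := fun r => \sum_j rho (curve u r) i j * v j k)).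
      by move=> r; rewrite mxE.
    elim: (index_enum _) => [|j s IH].
      by apply: polyfun_ext (polyfun_const 0) => r; rewrite big_nil.
    apply: polyfun_ext (polyfunD (polyfunM (rho_polyfun hrat cu _ i j) (polyfun_const (v j k))) IH).
      by move=> r; rewrite big_cons.
    move=> a b; apply: polyfun_ext (polyfunM (polyfun_const (u a b)) _) => [r|].
      by rewrite curveE.
    by exists 'X^(`|gr a - gr b|) => r; rewrite hornerXn.
  + by move=> j jj0 jd; apply: Cbig.
  move=> r r0; under eq_bigr => j _ do rewrite scalemxAl.
  rewrite -mulmx_suml -CE // -scalemxAl mulmxA -rM //; last exact: inSp_tau.
  rewrite -curve_up // rM //; last exact: inSp_tau.
  by rewrite -mulmxA (rho_tau_weight hv) // -scalemxAr scalerA powE.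
- move=> l hl tl.
  have cl r : inSp (curve l r) by apply: inSp_curve_dn.
  rewrite -[LHS]mulmx1 -C1 mulmx_sumr.
  rewrite (sumC_sub _ _ (fun j => xi *m E *m rho l *m C j) (fun r => xi *m E *m rho (curve l r))).
  + by rewrite curve0_dn // rho1 // mulmx1.
  + move=> i k; apply: (polyfun_ext (F := fun r => \sum_j (xi *m E) i j * rho (curve l r) j k)).
      by move=> r; rewrite mxE.
    elim: (index_enum _) => [|j s IH].
      by apply: polyfun_ext (polyfun_const 0) => r; rewrite big_nil.
    apply: polyfun_ext (polyfunD (polyfunM (polyfun_const ((xi *m E) i j)) (rho_polyfun hrat cl _ j k)) IH).
      by move=> r; rewrite big_cons.
    move=> a b; apply: polyfun_ext (polyfunM (polyfun_const (l a b)) _) => [r|].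
      by rewrite curveE.
    by exists 'X^(`|gr a - gr b|) => r; rewrite hornerXn.
  + by move=> j jj0 jd; rewrite Cbig0 // mulmx0.
  move=> r r0; under eq_bigr => j _ do rewrite scalemxAr.
  rewrite -mulmx_sumr -CE // -scalemxAr -(mulmxA (xi *m E)) -rM //; last exact: inSp_tau.
  rewrite -curve_dn // rM //; last exact: inSp_tau.
  have tn (i : 'I_n) : r ^+ (n - i) != 0 by apply: expf_neq0.
  rewrite mulmxA -(mulmxA xi) -[E *m rho (tau n r)](tauC _ tn) ETm // char_val_tau //.
  by rewrite -scalemxAr -scalemxAl scalerA powE // .
- by rewrite -mulmxA Ev.
- exact: tau_laurent.
exact: tauV_laurent.
Qed.

End RationalHighestWeight.

(** * Comparison of the two modules *)

Section Comparison.
Variables (P : closedFieldType) (n m N : nat) (chi : 'I_n -> int).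
Variables (rho : 'M[P]_(n + n) -> 'M[P]_m) (v : 'cV[P]_m) (vs : 'rV[P]_m).
Variables (sig : 'M[P]_(n + n) -> 'M[P]_N) (w : 'cV[P]_N) (ws : 'rV[P]_N).
Hypotheses (D1 : hw_data chi rho v vs) (D2 : hw_data chi sig w ws).
Hypothesis (hirr : is_irreducible rho).
(** The copy inside [sig] is the coordinate subspace of [A]: the orbit of [w] lies in it ([supp])
    and spans it ([cyc]), and [ws] detects each of its nonzero vectors ([cocyc]). *)
Variable A : {set 'I_N}.
Hypothesis supp : forall g k, inSp g -> k \notin A -> (sig g *m w) k 0 = 0.
Hypothesis cyc : forall x : 'rV[P]_N, (forall g, inSp g -> x *m sig g *m w = 0) ->
  forall k, k \in A -> x 0 k = 0.
Hypothesis cocyc : forall y : 'cV[P]_N, (forall g, inSp g -> ws *m sig g *m y = 0) ->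
  forall k, k \in A -> y k 0 = 0.

(** The vectors killed by all [vs *m rho g] form a stable subspace that does not contain [v]. *)
Lemma irr_cocyclic (x : 'cV[P]_m) :
  (forall g, inSp g -> vs *m rho g *m x = 0) -> x = 0.
Proof.
move=> hx; have [U [hU minU]] := span_pred (fun z : 'rV[P]_m =>
  forall g, inSp g -> vs *m rho g *m z^T = 0).
have US k (z : 'M[P]_(k, m)) g : (z <= U)%MS -> inSp g -> vs *m rho g *m z^T = 0.
  move=> zU hg; have : (z <= kermx (vs *m rho g)^T)%MS.
    apply: submx_trans zU _; apply: minU => y hy.
    by rewrite sub_kermx -trmx_eq0 trmx_mul trmxK hy.
  by rewrite sub_kermx -trmx_eq0 trmx_mul trmxK => /eqP.
have [_ /(_ U)[g hg|U0|Ufull]] := hirr.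
- apply/row_subP => i; apply: hU => h hh.
  rewrite row_mul trmx_mul trmxK -!mulmxA (mulmxA (rho h)) -(hw_M D1) // mulmxA.
  by apply: US; [apply: row_sub | apply: inSpM].
- have : (x^T <= U)%MS by apply: hU => g hg; rewrite trmxK hx.
  by rewrite U0 submx0 trmx_eq0 => /eqP.
have vU : (v^T <= U)%MS by apply: submx_full.
have := US _ _ _ vU (inSp1 P n); rewrite (hw_1 D1) mulmx1 trmxK (hw_pairing D1).
by move=> /matrixP/(_ 0 0)/eqP; rewrite !mxE eqxx oner_eq0.
Qed.

(* The graph of the isomorphism between [rho] and its copy inside [sig]. *)
Lemma hw_graph : exists U : 'M[P]_(m + N), [/\
  forall g (z : 'rV_(m + N)), inSp g -> (z <= U)%MS ->
    (row_mx (lsubmx z *m (rho g)^T) (rsubmx z *m (sig g)^T) <= U)%MS,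
  forall z : 'rV_(m + N), (z <= U)%MS -> lsubmx z = 0 -> rsubmx z = 0,
  forall z : 'rV_(m + N), (z <= U)%MS -> rsubmx z = 0 -> lsubmx z = 0,
  forall x : 'rV_m, exists2 z : 'rV_(m + N), (z <= U)%MS & lsubmx z = x
  & m = #|A|].
Proof.
have [U [hU minU]] := span_pred (fun z : 'rV[P]_(m + N) =>
  exists2 g, inSp g & z = row_mx (rho g *m v)^T (sig g *m w)^T).
(* Equality of the matrix coefficients, extended linearly from the generating pairs to the span. *)
have F0 (z : 'rV[P]_(m + N)) g : (z <= U)%MS -> inSp g ->
    vs *m rho g *m (lsubmx z)^T = ws *m sig g *m (rsubmx z)^T.
  move=> zU hg; pose M := col_mx (vs *m rho g)^T (- (ws *m sig g)^T).
  have : (z <= kermx M)%MS.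
    apply: submx_trans zU _; apply: minU => _ [h hh ->].
    rewrite sub_kermx mul_row_col mulmxN -!trmx_mul subr_eq0.
    apply/eqP; congr trmx; rewrite -!mulmxA (mulmxA (rho g)) (mulmxA (sig g)) -(hw_M D1) // -(hw_M D2) //.
    have := hw_coef_eq D1 D2 (inSpM hg hh); rewrite /hw_coef => E.
    by rewrite !mulmxA [LHS]mx11_scalar E -mx11_scalar.
  rewrite sub_kermx -{1}[z]hsubmxK mul_row_col mulmxN subr_eq0 => /eqP E.
  by apply: trmx_inj; rewrite !trmx_mul !trmxK -!trmx_mul.
have F1 k l (z : 'M[P]_(k, m + N)) i : (z <= U)%MS -> l \notin A -> (rsubmx z) i l = 0.
  move=> zU lA; pose M := col_mx 0 (delta_mx l 0) : 'cV[P]_(m + N).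
  have E k' (y : 'M[P]_(k', m + N)) : y *m M = col l (rsubmx y).
    by rewrite -{1}[y]hsubmxK mul_row_col mulmx0 add0r -colE.
  have : (z <= kermx M)%MS.
    apply: submx_trans zU _; apply: minU => _ [h hh ->].
    rewrite sub_kermx E row_mxKr; apply/eqP/matrixP => a b.
    by rewrite [RHS]mxE 2!mxE ord1 -[RHS](supp hh lA).
  by rewrite sub_kermx E => /eqP/matrixP/(_ i 0); rewrite !mxE.
have F2 g k (z : 'M[P]_(k, m + N)) : inSp g -> (z <= U)%MS ->
    (row_mx (lsubmx z *m (rho g)^T) (rsubmx z *m (sig g)^T) <= U)%MS.
  move=> hg zU; pose M := block_mx (rho g)^T 0 0 (sig g)^T.
  have E k' (y : 'M[P]_(k', m + N)) :
      y *m M = row_mx (lsubmx y *m (rho g)^T) (rsubmx y *m (sig g)^T).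
    by rewrite -{1}[y]hsubmxK mul_row_block !mulmx0 addr0 add0r.
  rewrite -E -preimage_sub; apply: submx_trans zU _; apply: minU => _ [h hh ->].
  rewrite preimage_sub; apply: hU; exists (g *m h); first exact: inSpM.
  by rewrite E row_mxKl row_mxKr -!trmx_mul !mulmxA (hw_M D1) // (hw_M D2).
have injl (z : 'rV[P]_(m + N)) : (z <= U)%MS -> lsubmx z = 0 -> rsubmx z = 0.
  move=> zU lz; apply/matrixP => i k; rewrite ord1 [RHS]mxE.
  case: (boolP (k \in A)) => [kA|]; last exact: F1.
  have := @cocyc (rsubmx z)^T _ k kA; rewrite mxE; apply=> g hg.
  by rewrite -F0 // lz trmx0 mulmx0.
have injr (z : 'rV[P]_(m + N)) : (z <= U)%MS -> rsubmx z = 0 -> lsubmx z = 0.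
  move=> zU rz; apply: trmx_inj; rewrite trmx0; apply: irr_cocyclic => g hg.
  by rewrite F0 // rz trmx0 mulmx0.
pose pl : 'M[P]_(m + N, m) := col_mx 1%:M 0; pose pr : 'M[P]_(m + N, N) := col_mx 0 1%:M.
have plE k (y : 'M[P]_(k, m + N)) : y *m pl = lsubmx y.
  by rewrite -{1}[y]hsubmxK mul_row_col mulmx0 addr0 mulmx1.
have prE k (y : 'M[P]_(k, m + N)) : y *m pr = rsubmx y.
  by rewrite -{1}[y]hsubmxK mul_row_col mulmx0 add0r mulmx1.
(* The projection of the graph to [rho] is stable and contains [v], so irreducibility makes it
   everything. *)
have full : row_full (U *m pl).
  have [_ /(_ <<U *m pl>>%MS)[g hg|U0|]] := hirr; last by rewrite /row_full genmxE.
    rewrite (eqmxMr _ (genmxE _)) genmxE plE.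
    have := F2 g _ U hg (submx_refl U) => /(submxMr pl).
    by rewrite !plE row_mxKl.
  have vU : (v^T <= U *m pl)%MS.
    have -> : v^T = row_mx v^T w^T *m pl by rewrite plE row_mxKl.
    apply: submxMr; apply: hU; exists 1%:M; first exact: inSp1.
    by rewrite (hw_1 D1) (hw_1 D2) !mul1mx.
  have := congr1 (fun M => (v^T <= M)%MS) U0; rewrite genmxE vU submx0 trmx_eq0 => /esym/eqP v0.
  have := hw_pairing D1; rewrite v0 mulmx0 => /matrixP/(_ 0 0)/eqP.
  by rewrite !mxE eq_sym oner_eq0.
have rank_inj k (q : 'M[P]_(m + N, k)) :
    (forall z : 'rV[P]_(m + N), (z <= U)%MS -> z *m q = 0 -> z = 0) -> \rank (U *m q) = \rank U.
  move=> hq; rewrite -[RHS](mxrank_mul_ker U q) -[LHS]addn0; congr (_ + _)%N.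
  apply/esym/eqP; rewrite mxrank_eq0; apply/eqP/row_matrixP => i; rewrite row0.
  apply: hq; first by apply: submx_trans (row_sub _ _) (capmxSl _ _).
  by apply/eqP; rewrite -sub_kermx; apply: submx_trans (row_sub _ _) (capmxSr _ _).
have rl : \rank (U *m pl) = \rank U.
  apply: rank_inj => z zU; rewrite plE => lz.
  by rewrite -[z]hsubmxK lz (injl _ zU lz) row_mx0.
have rr : \rank (U *m pr) = \rank U.
  apply: rank_inj => z zU; rewrite prE => rz.
  by rewrite -[z]hsubmxK rz (injr _ zU rz) row_mx0.
pose K : 'M[P]_(#|A|, N) := \matrix_(i, k) (k == enum_val i)%:R.
have KK : K *m K^T = 1%:M.
  apply/matrixP => i j; rewrite !mxE (bigD1 (enum_val i)) //= big1 ?addr0 => [|k ki].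
    by rewrite !mxE eqxx mul1r (inj_eq enum_val_inj).
  by rewrite !mxE (negPf ki) mul0r.
have KTK (z : 'rV[P]_N) : (forall k, k \notin A -> z 0 k = 0) -> z *m K^T *m K = z.
  move=> hz; apply/matrixP => i k; rewrite ord1 mxE.
  case: (boolP (k \in A)) => [kA|kA].
    rewrite (bigD1 (enum_rank_in kA k)) //= big1 ?addr0 => [|j jk].
      rewrite !mxE enum_rankK_in // eqxx mulr1 (bigD1 k) //= big1 ?addr0 => [|l lk].
        by rewrite !mxE enum_rankK_in // eqxx mulr1.
      by rewrite !mxE enum_rankK_in // (negPf lk) mulr0.
    rewrite [K j k]mxE; case: eqP => [kj|_]; last by rewrite mulr0.
    by case/eqP: jk; apply: enum_val_inj; rewrite enum_rankK_in.
  rewrite hz // big1 // => j _; rewrite [K j k]mxE; case: eqP kA => [->|_ _]; last by rewrite mulr0.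
  by rewrite enum_valP.
have rK : \rank K = #|A|.
  apply/eqP; rewrite eqn_leq rank_leq_row /= -{1}(mxrank1 P #|A|) -KK.
  exact: mxrankM_maxl.
(* A linear form vanishing on the projected graph vanishes on the orbit of [w], hence on the
   coordinates in [A] by [cyc]. *)
have KU : (K :=: U *m pr)%MS.
  apply/eqmxP/andP; split; apply/row_subP => i.
    rewrite submxE; apply/eqP/matrixP => a b; rewrite ord1 [RHS]mxE.
    have -> : row i K = delta_mx 0 (enum_val i).
      by apply/matrixP => c d; rewrite !mxE ord1 eqxx.
    rewrite -rowE mxE.
    have := @cyc (col b (cokermx (U *m pr)))^T _ (enum_val i) (enum_valP i).
    rewrite !mxE; apply=> g hg; apply: trmx_inj; rewrite trmx0 -mulmxA trmx_mul trmxK.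
    have : ((sig g *m w)^T <= U *m pr)%MS.
      have -> : (sig g *m w)^T = row_mx (rho g *m v)^T (sig g *m w)^T *m pr by rewrite prE row_mxKr.
      by apply: submxMr; apply: hU; exists g.
    by rewrite submxE => /eqP E; rewrite colE (mulmxA _ (cokermx _)) E mul0mx.
  rewrite -[row i _]KTK ?submxMl // => k kA; rewrite mxE prE; exact: F1.
exists U; split=> //.
- by move=> g z; apply: F2.
- move=> x; have /submxP [y yE] : (x <= U *m pl)%MS by apply: submx_full.
  by exists (y *m U); rewrite ?submxMl // -plE -mulmxA.
by rewrite -rK KU rr -rl; apply/esym/eqP.
Qed.

Lemma hw_dim : m = #|A|.
Proof. by have [U []] := hw_graph. Qed.

(** Weight vectors correspond under the graph: the pair [t z - mu(t) z] lies in the graph with first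
    component zero, so its second is zero too. *)
Lemma hw_mult (mu : 'I_n -> int) (x y : 'cV[P]_m) :
  (forall (y z : 'cV[P]_N), is_weight_vec sig mu y -> is_weight_vec sig mu z -> y != 0 ->
     exists a, z = a *: y) ->
  is_weight_vec rho mu x -> is_weight_vec rho mu y -> x != 0 -> exists a, y = a *: x.
Proof.
move=> hsig hx hy x0; have [U [Ustab injl injr surj _]] := hw_graph.
have lift (u : 'cV[P]_m) : is_weight_vec rho mu u -> exists z : 'rV[P]_(m + N),
    [/\ (z <= U)%MS, lsubmx z = u^T & is_weight_vec sig mu (rsubmx z)^T].
  move=> hu; have [z zU zu] := surj u^T; exists z; split=> // t ht.
  have hT := inSp_torus ht.
  pose z' := row_mx (lsubmx z *m (rho (torus_elt t))^T) (rsubmx z *m (sig (torus_elt t))^T)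
    - char_val mu t *: z.
  have z'U : (z' <= U)%MS.
    by apply: addmx_sub; [apply: Ustab | rewrite -scaleNr; apply: scalemx_sub].
  have lz' : lsubmx z' = 0.
    rewrite linearB /= row_mxKl linearZ /= zu -trmx_mul hu // linearZ /=.
    by rewrite subrr.
  have := injl _ z'U lz'; rewrite linearB /= row_mxKr linearZ /= => /eqP.
  rewrite subr_eq0 => /eqP E; apply: trmx_inj; rewrite trmx_mul trmxK E.
  by rewrite linearZ /= trmxK.
have [z [zU zx hz]] := lift x hx; have [z' [z'U z'y hz']] := lift y hy.
have rz0 : (rsubmx z)^T != 0.
  rewrite trmx_eq0; apply: contraNneq x0 => rz.
  by have := injr _ zU rz; rewrite zx => /eqP; rewrite trmx_eq0.
have [a ha] := hsig _ _ hz hz' rz0; exists a.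
have z2U : (z' - a *: z <= U)%MS.
  by apply: addmx_sub => //; rewrite -scaleNr; apply: scalemx_sub.
have rz2 : rsubmx (z' - a *: z) = 0.
  apply: trmx_inj; rewrite linearB linearZ /= linearB linearZ /= ha trmx0.
  by rewrite subrr.
have := injr _ z2U rz2; rewrite linearB linearZ /= zx z'y => /eqP.
rewrite subr_eq0 => /eqP E; apply: trmx_inj; rewrite E.
by rewrite linearZ.
Qed.

End Comparison.

(** * Weights and parity parts of the Weil representation *)

Section WeilHighestWeight.
Variables (P : closedFieldType) (p n : nat).
Hypotheses (hchar : p \in [pchar P]) (hp2 : (2 < p)%N).
Local Notation N := #|box p n|.
Local Notation e := (@e P p n hp2).
Local Notation es := (@es P p n hp2).
Local Notation par := (@par P p n hp2).
Local Notation Weil := (@Weil P p n hchar hp2).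
Lemma torusW_laurent (t : P -> 'I_n -> P) :
  (forall i, exists z : int, forall r, r != 0 -> t r i = r ^ z) ->
  (forall r, r != 0 -> forall i, t r i != 0) ->
  forall i j, laurent (fun r => Weil (torus_elt (t r)) i j).
Proof.
move=> /fin_all_exists [z hz] t0 i j.
pose chi := wt p (mnmb (enum_val i)).
apply: (laurent_ext (F := fun r => r ^ (\sum_k z k * chi k) * (i == j)%:R)).
  move=> r r0; rewrite Weil_torus; last exact: t0.
  rewrite !mxE mulr_natr -prod_expz_sum //; congr (_ *+ _).
  by apply: eq_bigr => k _; rewrite hz // exprz_exp.
by apply: laurentM; [apply: laurent_expz | apply: laurent_const].
Qed.

Lemma es_row (x : 'cV[P]_N) (k : 'I_N) : es (mnmb (enum_val k)) *m x = (x k 0)%:M.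
Proof.
rewrite /es /e inbox_mnmb mnmbK enum_valK trmx_delta -rowE.
by apply/matrixP => i j; rewrite !ord1 !mxE eqxx.
Qed.

Lemma e_col (x : 'rV[P]_N) (k : 'I_N) : x *m e (mnmb (enum_val k)) = (x 0 k)%:M.
Proof.
rewrite /e inbox_mnmb mnmbK enum_valK -colE.
by apply/matrixP => i j; rewrite !ord1 !mxE eqxx.
Qed.

Lemma es_par a : es a *m par = (-1) ^+ mdeg a *: es a.
Proof.
apply: mx_ext => b hb; rewrite -mulmxA par_e -scalemxAr -scalemxAl es_e //.
by case: eqP => [->|]; rewrite ?raddf0 ?scaler0.
Qed.

(** Distinct monomials differ in some exponent, and the corresponding coordinate torus separates
    their characters, so a weight vector has a single nonzero coordinate. *)
Lemma Weil_weight_mult (mu : 'I_n -> int) (y z : 'cV[P]_N) :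
  is_weight_vec Weil mu y -> is_weight_vec Weil mu z -> y != 0 -> exists a, z = a *: y.
Proof.
move=> hy hz y0.
have [k yk] : exists k, y k 0 != 0.
  apply: NNPP => h; case/eqP: y0; apply/colP => k; rewrite mxE.
  by apply/eqP; apply: contraT => yk; case: h; exists k.
have coordE (x : 'cV[P]_N) l (t : 'I_n -> P) : is_weight_vec Weil mu x -> (forall i, t i != 0) ->
    char_val (wt p (mnmb (enum_val l))) t * x l 0 = char_val mu t * x l 0.
  move=> hx ht; have := congr1 (mulmx (es (mnmb (enum_val l)))) (hx t ht).
  rewrite mulmxA Weil_torus_es // -scalemxAl -scalemxAr es_row => /matrixP/(_ 0 0).
  by rewrite !mxE eqxx !mulr1n.
have zero (x : 'cV[P]_N) l : is_weight_vec Weil mu x -> l != k -> x l 0 = 0.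
  move=> hx lk; pose cl : box p n := enum_val l; pose ck : box p n := enum_val k.
  have [i hi] : exists i, cl i != ck i.
    apply: NNPP => h; case/eqP: lk; apply: enum_val_inj; apply/ffunP => i.
    by apply/eqP; apply: contraT => ne; case: h; exists i.
  have wne : wt p (mnmb cl) i != wt p (mnmb ck) i.
    apply: contra hi; rewrite /wt !mnmE => /eqP E; apply/eqP/val_inj => /=.
    by move: E; lia.
  have [r r0 hr] := expz_generic P wne.
  have t0 := coord_neq0 i r0.
  have cv chi : char_val chi (coord i r) = r ^ chi i.
    rewrite /char_val (bigD1 i) //= big1 /coord ?eqxx ?mulr1 // => j ji.
    by rewrite (negPf ji) exp1rz.
  have mk : char_val mu (coord i r) = r ^ wt p (mnmb ck) i.
    by have := coordE y k _ hy t0; rewrite cv => /(mulIf yk) ->.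
  have := coordE x l _ hx t0; rewrite cv mk => /eqP; rewrite -subr_eq0 -mulrBl mulf_eq0.
  by rewrite subr_eq0 (negPf hr) => /eqP.
exists (z k 0 / y k 0); apply/colP => l; rewrite mxE.
case: (eqVneq l k) => [->|lk]; first by rewrite mulfVK.
by rewrite (zero z l) // (zero y l) // mulr0.
Qed.

(** The trace of [par]: it factors over the variables, and each alternating sum of length p is 1
    because p is odd. *)
Lemma sum_sign : \sum_(x : box p n) (-1) ^+ mdeg (mnmb x) = 1 :> int.
Proof.
have E (x : box p n) : (-1) ^+ mdeg (mnmb x) = \prod_i (-1) ^+ (x i : nat) :> int.
  rewrite mdegE (big_morph (fun k => (-1) ^+ k : int) (id1 := 1) (op1 := *%R)) //.
    by apply: eq_bigr => i _; rewrite mnmE.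
  by move=> a b; rewrite exprD.
rewrite (eq_bigr _ (fun x _ => E x)).
rewrite -(bigA_distr_bigA (fun (i : 'I_n) (j : 'I_p) => (-1) ^+ (j : nat) : int)) big1 // => i _.
have alt q : \sum_(j < q) (-1) ^+ j = (odd q)%:R :> int.
  elim: q => [|q IH]; first by rewrite big_ord0.
  rewrite big_ord_recr /= IH -signr_odd; case: (odd q); first by rewrite expr1 subrr.
  by rewrite expr0 add0r.
by rewrite alt (odd_p hchar hp2).
Qed.

Variables (a0 : 'X_{1..n}) (i0 : 'I_n).
Hypotheses (hi0 : i0.+1 = n) (ha0 : a0 = 0%MM \/ a0 = U_(i0)%MM).

Let ain : inbox p a0.
Proof. by case: ha0 => ->; [apply: inbox0 | apply: inbox1]. Qed.

Lemma Weil_hw_data : hw_data (wt p a0) Weil (e a0) (es a0).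
Proof.
split.
- exact: Weil1.
- exact: WeilM.
- by move=> t ht; apply: Weil_torus_e.
- by move=> t ht; apply: Weil_torus_es.
- by move=> u hu tu; case: ha0 => ->; [apply: Weil_up_e0 | apply: Weil_up_e1].
- by move=> l hl tl; case: ha0 => ->; [apply: Weil_dn_es0 | apply: Weil_dn_es1].
- by rewrite es_e // eqxx.
- apply: torusW_laurent => [i|r r0 i]; last exact: expf_neq0.
  by exists (n - i)%:Z.
apply: torusW_laurent => [i|r r0 i]; last by rewrite expf_neq0 ?invr_eq0.
by exists (- (n - i)%:Z) => r _; rewrite exprVn exprnN.
Qed.

Definition parity_class : {set 'I_N} :=
  [set k | odd (mdeg (mnmb (enum_val k))) == odd (mdeg a0)].

(** [Weil g] commutes with [par], so the orbit stays in one eigenspace; the eigenvalues 1 and -1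
    differ because p is odd. *)
Lemma Weil_supp g k : inSp g -> k \notin parity_class -> (Weil g *m e a0) k 0 = 0.
Proof.
move=> hg; rewrite inE; set b := mnmb (enum_val k) => hodd.
have : es b *m par *m (Weil g *m e a0) = (-1) ^+ mdeg a0 *: (es b *m (Weil g *m e a0)).
  by rewrite -mulmxA (mulmxA par) -Weil_par // -(mulmxA (Weil g)) par_e -!scalemxAr.
rewrite es_par -scalemxAl es_row => /matrixP/(_ 0 0); rewrite !mxE eqxx !mulr1n.
move/eqP; rewrite -subr_eq0 -mulrBl mulf_eq0 => /orP[|/eqP //].
rewrite -signr_odd -[X in _ - X]signr_odd.
case: (odd (mdeg b)) (odd (mdeg a0)) hodd => [] [] // _.
  by rewrite expr0 expr1 -opprD oppr_eq0 (negPf (two_neq0 hchar hp2)).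
by rewrite expr0 expr1 opprK (negPf (two_neq0 hchar hp2)).
Qed.

(** The summand [1 + (-1) ^+ mdeg a0 * (-1) ^+ mdeg b] is twice the indicator of the class. *)
Lemma card_parity_class : (2 * #|parity_class|)%:Z = (p ^ n)%:Z + (-1) ^+ mdeg a0.
Proof.
transitivity (\sum_(k : 'I_N) (1 + (-1) ^+ mdeg a0 * (-1) ^+ mdeg (mnmb (enum_val k)) : int)).
  rewrite (bigID (mem parity_class)) /= [X in _ = _ + X]big1 ?addr0 => [|k].
    rewrite (eq_bigr (fun=> 2)) => [|k]; last first.
      rewrite inE => /eqP hk; rewrite -signr_odd -[X in _ * X]signr_odd hk.
      by rewrite -expr2 sqrr_sign.
    by rewrite sumr_const -[RHS]mulr_natr PoszM !natz.
  rewrite inE -signr_odd -[X in _ * X]signr_odd.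
  by case: (odd _) (odd _) => [] [].
rewrite big_split /= sumr_const card_ord -big_distrr /=.
have -> : \sum_(k : 'I_N) (-1) ^+ mdeg (mnmb (enum_val k)) = 1 :> int.
  rewrite -sum_sign [RHS](reindex (fun k : 'I_N => enum_val k)) //=.
  by exists enum_rank => x _; rewrite ?enum_valK ?enum_rankK.
by rewrite mulr1 N_expn natz.
Qed.

End WeilHighestWeight.

(** * Identification of the two highest weights and conclusion *)

Lemma hw_data_ext (P : closedFieldType) n (chi psi : 'I_n -> int) k (sig : 'M[P]_(n + n) -> 'M[P]_k) v vs :
  chi =1 psi -> hw_data chi sig v vs -> hw_data psi sig v vs.
Proof.
move=> E [*]; split=> // t ht.
all: have -> : char_val psi t = char_val chi t by apply: eq_bigr => i _; rewrite E.
all: by auto.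
Qed.

(** omega_(n-1) adds 1 to every coordinate but the last, turning (p-3)/2 into (p-1)/2 there and
    leaving the weight of x_n. *)
Lemma omega'_wt n p (i0 : 'I_n) : (2 < p)%N -> i0.+1 = n -> omega' n p =1 wt p U_(i0)%MM.
Proof.
move=> hp2 hi0 j; rewrite /omega' /wt mnm1E /fund_weight /=.
have jn := ltn_ord j.
have -> : ((p - 1)./2 = ((p - 3)./2).+1)%N.
  by case: p hp2 => [|[|[|q]]] // _; rewrite !subSS !subn0.
case: (ltnP 1 n) => hn; last first.
  have -> : (j < 1)%N = true by lia.
  have -> : i0 == j by apply/eqP/val_inj => /=; lia.
  by rewrite mulr1; lia.
rewrite jn mulr1; case: eqP => [<-|/eqP ne].
  have -> : (i0 < n.-1)%N = false by lia.
  by rewrite add0r; lia.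
have -> : (j < n.-1)%N = true by move: ne; rewrite -val_eqE /=; lia.
lia.
Qed.

Lemma omega''_wt n p : omega'' n p =1 wt p (0%MM : 'X_{1..n}).
Proof.
by move=> j; rewrite /omega'' /wt mnm0E /fund_weight ltn_ord mulr1 subr0.
Qed.

Theorem theorem1 (P : closedFieldType) (p : nat)
  (hp : prime p) (hchar : p \in [pchar P]) (hp2 : (2 < p)%N)
  (n : nat) (hn : (0 < n)%N) (i : nat) (hi : i = 1%N \/ i = 2%N)
  (m : nat) (rho : 'M[P]_(n + n) -> 'M[P]_m) :
  is_rational_rep rho -> is_irreducible rho ->
  has_highest_weight rho (if i == 1%N then omega' n p else omega'' n p) ->
  ((2 * m)%:Z = (p ^ n)%:Z + (-1) ^+ i)
  /\ (forall (chi : 'I_n -> int) (u v : 'cV[P]_m),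
        is_weight_vec rho chi u -> is_weight_vec rho chi v -> u != 0 ->
        exists a : P, v = a *: u).
Proof.
move=> hrat hirr hhw; have := ltn_predK hn; set q := n.-1 => qn.
pose i0 : 'I_n := Ordinal (eq_leq qn).
have hi0 : i0.+1 = n by [].
(* The odd part belongs to [i = 1] and the even part to [i = 2], so [(-1) ^+ mdeg a0] is
   [(-1) ^+ i]. *)
pose a0 : 'X_{1..n} := if i == 1%N then U_(i0)%MM else 0%MM.
have ha0 : a0 = 0%MM \/ a0 = U_(i0)%MM by rewrite /a0; case: ifP => _; [right | left].
have [v [vs D]] := rational_hw_data hrat hhw.
have {}D : hw_data (wt p a0) rho v vs.
  apply: hw_data_ext D => j; rewrite /a0; case: ifP => _; last exact: omega''_wt.
  exact: omega'_wt.
have DW := Weil_hw_data hchar hp2 hi0 ha0.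
have cls k : k \in parity_class p a0 -> odd (mdeg (mnmb (enum_val k : box p n))) = odd (mdeg a0).
  by rewrite inE => /eqP.
have cyc (x : 'rV[P]_#|box p n|) : (forall g, inSp g -> x *m Weil hchar hp2 g *m e P hp2 a0 = 0) ->
    forall k, k \in parity_class p a0 -> x 0 k = 0.
  move=> hx k /cls hk; have := Weil_cyclic ha0 hx (inbox_mnmb _) hk.
  by rewrite e_col => /matrixP/(_ 0 0); rewrite !mxE eqxx.
have cocyc (y : 'cV[P]_#|box p n|) : (forall g, inSp g -> es P hp2 a0 *m Weil hchar hp2 g *m y = 0) ->
    forall k, k \in parity_class p a0 -> y k 0 = 0.
  move=> hy k /cls hk; have := Weil_cocyclic ha0 hy (inbox_mnmb _) hk.
  by rewrite es_row => /matrixP/(_ 0 0); rewrite !mxE eqxx.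
have supp := @Weil_supp P p n hchar hp2 a0.
split; last first.
  move=> chi u u' hu hu' u0.
  exact: (hw_mult D DW hirr supp cyc cocyc (@Weil_weight_mult P p n hchar hp2 chi) hu hu' u0).
rewrite (hw_dim D DW hirr supp cyc cocyc) (card_parity_class hchar hp2); congr (_ + _).
by case: hi => E; rewrite /a0 E /= ?mdeg1 ?mdeg0.
Qed.
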